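(* There is a set $A\subseteq\mathbb N$ of natural density one such that distinct consecutive blocks in the increasing enumeration of $A$ have distinct products. That is, if $d_1<d_2<\cdots$ is the increasing enumeration of $A$, then the map $(u,v)\mapsto\prod_{i=u}^{v}d_i$, defined on pairs of integers with $1\le u\le v$, is injective.
   Context: $\mathbb N$ denotes the positive integers. A set $A\subseteq\mathbb N$ has natural density one if $|A\cap[1,X]|/X\to1$ as $X\to\infty$. *)

(* Defs.v *)
From mathcomp Require Import all_boot all_order all_algebra.
From mathcomp Require Import all_classical all_reals all_analysis.
Import numFieldNormedType.Exports.

Set Implicit Arguments.
Unset Strict Implicit.
Unset Printing Implicit Defensive.

Import Order.TTheory GRing.Theory Num.Theory.

Local Open Scope classical_set_scope.
Local Open Scope ring_scope.

(* |A `&` [1, X]|; iota 1 X lists 1, ..., X. *)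
Definition counting_function (A : set nat) (X : nat) : nat :=
  count (fun n => n \in A) (iota 1 X).

(* X ranges over the integers; the value at X = 0 (where 0 / 0 = 0) does not
   affect the limit. *)
Definition natural_density_one (R : realType) (A : set nat) : Prop :=
  ((counting_function A X)%:R / X%:R : R) @[X --> \oo] --> (1 : R).

(* The enumeration is 1-based: d 0 is junk and is left unconstrained. *)
Definition increasing_enumeration (A : set nat) (d : nat -> nat) : Prop :=
  (forall i j : nat, (1 <= i)%N -> (i < j)%N -> (d i < d j)%N) /\
  d @` [set i : nat | (1 <= i)%N] = A.

Definition block_product (d : nat -> nat) (u v : nat) : nat :=
  (\prod_(u <= i < v.+1) d i)%N.

(* Main.v *)
Require Import Defs.
From mathcomp Require Import all_boot all_order all_algebra.
From mathcomp Require Import all_classical all_reals all_analysis.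
From mathcomp Require Import zify ring lra.
Import numFieldNormedType.Exports.
Import Order.TTheory GRing.Theory Num.Theory.

(** Cancelling the common part of two blocks with equal products leaves disjoint
blocks I before J.  So a set built greedily has the required property: a new
element y is refused when some block ending at y would have the same product as
an earlier block I.  A density-zero set of integers is also refused: those
without a prime factor exceeding a threshold that is larger than the windows
considered below, and those rejected by rare coins.

Write s for the scale of y, 2 ^ (s ^ 4) <= y < 2 ^ ((s + 1) ^ 4); coins reject
with probability 1/s.  In a refusal |I| > |J|, and refusals are rare for each size of J.
- |J| at most about s ^ 3: I and |J| determine y, and the elements of I are at
  most y / 2 ^ s, so there are few such I.
- |J| larger: since elements close together have private large primes, the
  product of J determines J, and all of J but y must have survived its coin, which
  has probability at most (1 - 1/s) ^ (|J| - 1).  A block J of more than about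
  s ^ 5 elements is cut to its last 2 ^ s integers, and the probability beats the
  number of candidates, so such refusals never occur.
The cut requires that windows of length 2 ^ s contain many elements of the set.
This is deterministic: between consecutive elements, the blocks I of a given size
that clash with a J of a given size all contain the same multiple of a private
prime of J, so there are only polynomially many refusals (in s).

The coins are derandomized by conditional expectations, the potential being the
number of rejections plus the expected realized_cost of the threats known so far. *)

(** * Elementary estimates and smooth numbers *)

Lemma poly_le_exp2 (C D : nat) : exists s0, forall s, s0 <= s -> D * s.+1 ^ C <= 2 ^ s.
Proof.
case: (posnP C) => [->|C0].
  exists D => s Ds; rewrite expn0 muln1; apply: leq_trans Ds _.
  by apply/ltnW/ltn_expl.
(* With [m = s / (2C)] one has [s + 1 <= 2C 2 ^ m], so the left side is at most
   [D (2C) ^ C 2 ^ (mC)]. The witness forces [D (2C) ^ C <= m <= 2 ^ m], and [m (C + 1) <= s]. *)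
exists (2 * C * (D * (2 * C) ^ C)) => s sB.
pose m := s %/ (2 * C); pose r := s %% (2 * C).
have sE : s = m * (2 * C) + r by exact: divn_eq.
have rlt : r < 2 * C by rewrite ltn_mod muln_gt0.
have mB : D * (2 * C) ^ C <= m by rewrite leq_divRL ?muln_gt0 // mulnC.
have s1 : s.+1 <= 2 * C * 2 ^ m.
  apply: (@leq_trans (2 * C * m.+1)); first by rewrite sE; nia.
  by rewrite leq_mul2l orbC ltn_expl.
apply: (@leq_trans (D * (2 * C * 2 ^ m) ^ C)).
  by rewrite leq_mul2l leq_exp2r // s1 orbT.
rewrite expnMn mulnA; apply: (@leq_trans (2 ^ m * (2 ^ m) ^ C)).
  rewrite leq_mul2r; apply/orP; right; apply: leq_trans mB _.
  by apply/ltnW/ltn_expl.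
by rewrite -expnS -expnM leq_exp2l // sE; nia.
Qed.

Lemma poly_le_exp2_eventually (C D : nat) (f : nat -> nat) :
  (forall s, f s <= D * s.+1 ^ C) -> exists s0, forall s, s0 <= s -> f s <= 2 ^ s.
Proof.
move=> fB; have [s0 h] := poly_le_exp2 C D; exists s0 => s /h; exact: leq_trans (fB s).
Qed.

Definition smooth (R n : nat) : bool := all (leq^~ R) (primes n).

Lemma smoothPn R n : 0 < n -> ~~ smooth R n -> exists p, [/\ prime p, p %| n & R < p].
Proof.
move=> n0; rewrite -has_predC => /hasP[p]; rewrite mem_primes n0 /= -ltnNge.
by case/andP=> pp pn Rp; exists p.
Qed.

Lemma smooth_le R n p : smooth R n -> 0 < n -> prime p -> p %| n -> p <= R.
Proof. by move=> /allP h n0 pp pn; apply: h; rewrite mem_primes pp n0. Qed.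

Lemma seq_max (f : nat -> nat) (s : seq nat) : s != [::] ->
  {m | m \in s & forall n, n \in s -> f n <= f m}.
Proof.
elim: s => // a [|b s] IHs _.
  by exists a; rewrite ?mem_head // => n; rewrite inE => /eqP ->.
have [//|m ms h] := IHs; case: (leqP (f a) (f m)) => am.
  exists m; first by rewrite inE ms orbT.
  by move=> n; rewrite inE => /orP[/eqP ->|/h].
exists a; first by rewrite mem_head.
by move=> n; rewrite inE => /orP[/eqP ->//|/h] /leq_trans; apply; apply: ltnW.
Qed.

Definition dist (m n : nat) := (n - m) + (m - n).

(** Left neighbours give [a!], right ones [b!]. In the count of smooth numbers the centre is a
    discarded number of maximal valuation, and [a! b!] divides the factorial of the window
    length. *)
Lemma prod_dist_iota t a b :
  \prod_(n <- iota t a ++ iota (t + a).+1 b) dist (t + a) n = a`! * b`!.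
Proof.
rewrite big_cat /=; congr (_ * _).
  elim: a t => [|a IHa] t; first by rewrite big_nil.
  rewrite /= big_cons addnS -addSn IHa factS /dist; congr (_ * _); lia.
rewrite [in RHS]fact_prod -{1}[(t + a).+1]add1n -[1 + _]addnC iotaDl big_map.
rewrite /index_iota subSS subn0; apply: eq_bigr => i _; rewrite /dist; lia.
Qed.

Lemma prod_filter_dvdn (s : seq nat) (P : pred nat) (f : nat -> nat) :
  \prod_(n <- s | P n) f n %| \prod_(n <- s) f n.
Proof. by rewrite [X in _ %| X](bigID P) /= dvdn_mulr. Qed.

Lemma prod_seq_dvdn (s : seq nat) (f g : nat -> nat) :
  (forall n, n \in s -> f n %| g n) -> \prod_(n <- s) f n %| \prod_(n <- s) g n.
Proof.
elim: s => [|a s IHs] h; first by rewrite !big_nil.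
rewrite !big_cons dvdn_mul ?h ?mem_head // IHs // => n ns.
by rewrite h // inE ns orbT.
Qed.

Lemma partn_prod_seq (s : seq nat) p : (forall n, n \in s -> 0 < n) ->
  (\prod_(n <- s) n)`_p = \prod_(n <- s) n`_p.
Proof.
elim: s => [|a s IHs] h; first by rewrite !big_nil partn1.
rewrite !big_cons partnM ?IHs //; first by move=> n ns; rewrite h // inE ns orbT.
  by rewrite h ?mem_head.
by rewrite big_seq prodn_cond_gt0 // => n ns; rewrite h // inE ns orbT.
Qed.

(* Erdos's argument: for every prime p <= R discard one smooth number of maximal
   p-adic valuation; the product of the others divides T!. *)
Lemma smooth_count t T R : 0 < t ->
  exists2 e, count (smooth R) (iota t T) <= count prime (iota 0 R.+1) + e &
    t ^ e <= T`!.
Proof.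
move=> t0; set F := seq.filter (smooth R) (iota t T).
have [F0|Fn] := eqVneq F [::].
  by exists 0; rewrite -?size_filter -?/F ?F0 // expn0 fact_gt0.
pose mx p := s2val (seq_max (logn p) F Fn).
have mxF p : mx p \in F by exact: s2valP (seq_max (logn p) F Fn).
have mxP p n : n \in F -> logn p n <= logn p (mx p).
  exact: (s2valP' (seq_max (logn p) F Fn)).
pose P := seq.filter prime (iota 0 R.+1).
pose F' := seq.filter (fun n => n \notin map mx P) F.
have Fpos n : n \in F -> t <= n < t + T by rewrite mem_filter mem_iota => /andP[].
have F'F n : n \in F' -> n \in F by rewrite mem_filter => /andP[].
exists (size F').
  rewrite -[count (smooth R) _]size_filter -[count prime _]size_filter -/F -/P.
  rewrite -(count_predC (fun n => n \notin map mx P) F) addnC.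
  apply: leq_add; last by rewrite /F' size_filter.
  rewrite -size_filter.
  rewrite -(size_map mx P); apply: uniq_leq_size.
    by rewrite !filter_uniq // iota_uniq.
  by move=> n; rewrite mem_filter /= negbK => /andP[].
have F't n : n \in F' -> t <= n by move=> /F'F/Fpos/andP[].
apply: (@leq_trans (\prod_(n <- F') n)).
  elim: F' F't {F'F} => [|n s IHs] st; first by rewrite big_nil.
  rewrite big_cons expnS leq_mul ?st ?mem_head // IHs // => k ks.
  by rewrite st // inE ks orbT.
apply: dvdn_leq; first exact: fact_gt0.
have F'0 n : n \in F' -> 0 < n.
  by move=> /F'F/Fpos/andP[tn _]; exact: leq_trans tn.
apply/dvdn_partP.
  by rewrite big_seq prodn_cond_gt0.
move=> p; rewrite mem_primes => /and3P[pp _ pdv].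
have pP : p \in P.
  have : has (dvdn p) F'.
    apply: contraLR pdv; rewrite -all_predC => /allP nd.
    rewrite -prime_coprime // big_seq; elim/big_rec: _ => [|n x ns cx].
      exact: coprimen1.
    by rewrite coprimeMr cx andbT prime_coprime //; exact: nd.
  case/hasP=> n nF' pn; rewrite mem_filter pp mem_iota /= add0n ltnS.
  have := F'F _ nF'; rewrite mem_filter => /andP[sn _].
  exact: smooth_le sn (F'0 _ nF') pp pn.
have /andP[tm mT] := Fpos _ (mxF p).
pose a := mx p - t; pose b := t + T - (mx p).+1.
have mE : mx p = t + a by rewrite /a; lia.
have TE : T = a + b.+1 by rewrite /a /b; lia.
rewrite partn_prod_seq //.
have nmx n : n \in F' -> n != mx p.
  rewrite mem_filter => /andP[nP _]; apply: contraNneq nP => ->.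
  exact: map_f.
(* The [p]-part of [n] divides [mx p] too, by maximality, hence divides their distance. *)
apply: (@dvdn_trans (\prod_(n <- F') dist (mx p) n)).
  apply: prod_seq_dvdn => n nF'; rewrite p_part /dist; have vn := mxP p n (F'F _ nF').
  have dn : p ^ logn p n %| n by exact: pfactor_dvdnn.
  have dm : p ^ logn p n %| mx p.
    by apply: dvdn_trans (dvdn_exp2l _ vn) _; exact: pfactor_dvdnn.
  by rewrite dvdn_addr dvdn_sub.
apply: (@dvdn_trans (a`! * b`!)); last first.
  rewrite TE addnS; apply: (@dvdn_trans (a + b)`!).
    by rewrite -(bin_fact (leq_addr b a)) addKn dvdn_mull.
  by rewrite factS dvdn_mull.
rewrite -(prod_dist_iota t) -mE.
have -> : F' = [seq n <- iota t a ++ iota (mx p).+1 b | (n \notin map mx P) && smooth R n].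
  rewrite /F' /F -filter_predI TE iotaD /= -mE !filter_cat /=; congr (_ ++ _).
  by rewrite map_f.
by rewrite big_filter prod_filter_dvdn.
Qed.

(** Apart from 2 and 3, primes are 1 or 5 modulo 6. Density 1/3 is small enough for
    [populated_step]. *)
Lemma count_prime_iota n : 3 * count prime (iota 0 n) <= n + 12.
Proof.
pose q p := (p %% 6 == 1) || (p %% 6 == 5).
have primeq p : prime p -> [|| p == 2, p == 3 | q p].
  move=> pp; have [//|p2] := eqVneq p 2; have [//|p3] := eqVneq p 3.
  have n2 : ~~ (2 %| p) by rewrite dvdn_prime2 // eq_sym.
  have n3 : ~~ (3 %| p) by rewrite dvdn_prime2 // eq_sym.
  rewrite /q /=; lia.
have qE t a : count q (iota (6 * t) (6 * a)) = 2 * a.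
  elim: a t => [|a IHa] t; first by rewrite muln0.
  rewrite mulnS iotaD count_cat.
  rewrite (_ : 6 * t + 6 = 6 * t.+1); last by rewrite mulnS addnC.
  rewrite IHa /= /q.
  have -> : (6 * t) %% 6 = 0 by lia.
  have -> : (6 * t).+1 %% 6 = 1 by lia.
  have -> : (6 * t).+2 %% 6 = 2 by lia.
  have -> : (6 * t).+3 %% 6 = 3 by lia.
  have -> : (6 * t).+4 %% 6 = 4 by lia.
  have -> : (6 * t).+4.+1 %% 6 = 5 by lia.
  by rewrite /=; lia.
have qn : count q (iota 0 n) <= 2 * (n %/ 6).+1.
  rewrite -(qE 0) muln0 (_ : 6 * (n %/ 6).+1 = n + (6 * (n %/ 6).+1 - n)); last lia.
  by rewrite iotaD count_cat leq_addr.
suff : count prime (iota 0 n) <= count (pred2 2 3) (iota 0 n) + count q (iota 0 n).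
  have : count (pred2 2 3) (iota 0 n) <= 2.
    rewrite -size_filter -[2]/(size [:: 2; 3]); apply: uniq_leq_size.
      by rewrite filter_uniq // iota_uniq.
    by move=> x; rewrite mem_filter !inE => /andP[].
  lia.
rewrite -count_predUI; apply: leq_trans (leq_addr _ _).
by apply: sub_count => p /primeq /=; rewrite orbA.
Qed.

(** Tile by consecutive windows. One [n] pays for the full windows, the other for the advance of the
    starting point, which bounds [q] times the length of the last, incomplete window. *)
Lemma count_tile (P : pred nat) (len : nat -> nat) (q N0 : nat) :
  (forall t, N0 <= t -> [/\ 0 < len t, q * len t <= t &
     q * count P (iota t (len t)) <= len t]) ->
  forall n, q * count P (iota N0 n) <= N0 + n.*2.
Proof.
move=> h; suff main n : forall t, N0 <= t -> q * count P (iota t n) <= t + n.*2.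
  by move=> n; apply: main.
elim/ltn_ind: n => n IHn t N0t; have [l0 lt cl] := h t N0t.
have [nl|ln] := ltnP n (len t).
  apply: leq_trans (leq_trans lt (leq_addr _ _)).
  rewrite leq_mul2l; apply/orP; right; apply: leq_trans (count_size _ _) _.
  by rewrite size_iota ltnW.
have -> : iota t n = iota t (len t) ++ iota (t + len t) (n - len t).
  by rewrite -iotaD subnKC.
have nl : n - len t < n by lia.
have := IHn _ nl (t + len t) (leq_trans N0t (leq_addr _ _)).
rewrite count_cat mulnDr; lia.
Qed.

(** * Derandomization *)

(** Support, tag, cost, and the weights of an accepting ([true]) and a rejecting ([false]) coin. A
    threat stands for the random variable equal to its cost times the product of the weights of the
    coins in its support. *)
Notation threat := (seq nat * nat * rat * (rat * rat))%type.

Definition tsupp (th : threat) : seq nat := th.1.1.1.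
Definition ttag (th : threat) : nat := th.1.1.2.
Definition tcost (th : threat) : rat := th.1.2.
Definition twt (th : threat) (b : bool) : rat :=
  if b then th.2.1 else th.2.2.

Section Derandomization.

Local Open Scope ring_scope.

Variable delta : nat -> rat.
Hypothesis delta01 : forall n, 0 <= delta n <= 1.

Definition mean_wt (th : threat) (m : nat) : rat :=
  (1 - delta m) * twt th true + delta m * twt th false.

(** The conditional expectation of the product of weights once the coins below [n] are fixed, coin
    [m] rejecting with probability [delta m]. *)
Definition weight (c : nat -> bool) (n : nat) (th : threat) : rat :=
  \prod_(m <- tsupp th) (if (m < n)%N then twt th (c m) else mean_wt th m).

Definition threat_ok (t : nat) (th : threat) : bool :=
  [&& uniq (tsupp th), all (leq t) (tsupp th), 0 <= tcost th,
      0 <= twt th true & 0 <= twt th false].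

Lemma mean_wt_ge0 t th m : threat_ok t th -> 0 <= mean_wt th m.
Proof.
move=> /and5P[_ _ _ h1 h0]; have /andP[d0 d1] := delta01 m.
by rewrite /mean_wt addr_ge0 // mulr_ge0 // subr_ge0.
Qed.

Lemma weight_ge0 c n t th : threat_ok t th -> 0 <= weight c n th.
Proof.
move=> ok; apply: prodr_ge0 => m _; case: ifP => _; last exact: mean_wt_ge0 ok.
by case/and5P: ok => _ _ _ h1 h0; case: (c m).
Qed.

Lemma weight_eq c c' n th :
  (forall m, (m < n)%N -> c m = c' m) -> weight c n th = weight c' n th.
Proof. by move=> h; apply: eq_bigr => m _; case: ifP => // /h ->. Qed.

Lemma weight_start c t th : threat_ok t th ->
  weight c t th = \prod_(m <- tsupp th) mean_wt th m.
Proof.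
case/and5P=> _ /allP h _ _ _; apply: eq_big_seq => m /h.
by rewrite leqNgt => /negbTE ->.
Qed.

(** The martingale property: only the factor of coin [n] changes, and it occurs at most once because
    the support has no repetition. *)
Lemma weight_mean (c c1 c0 : nat -> bool) n t th : threat_ok t th ->
  (forall m, (m < n)%N -> c m = c1 m) -> (forall m, (m < n)%N -> c m = c0 m) ->
  c1 n = true -> c0 n = false ->
  (1 - delta n) * weight c1 n.+1 th + delta n * weight c0 n.+1 th =
  weight c n th.
Proof.
move=> ok h1 h0 c1n c0n; rewrite /weight.
have eqo c' m : (forall m, (m < n)%N -> c m = c' m) -> m != n ->
    (if (m < n.+1)%N then twt th (c' m) else mean_wt th m) =
    (if (m < n)%N then twt th (c m) else mean_wt th m).
  move=> h mn; rewrite ltnS leq_eqVlt (negbTE mn) /=.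
  by case: ifP => // /h ->.
case/and5P: ok => us _ _ _ _.
have [nin|nout] := boolP (n \in tsupp th); last first.
  have E c' : (forall m, (m < n)%N -> c m = c' m) ->
    \prod_(m <- tsupp th) (if (m < n.+1)%N then twt th (c' m) else mean_wt th m)
    = \prod_(m <- tsupp th) (if (m < n)%N then twt th (c m) else mean_wt th m).
    move=> h; apply: eq_big_seq => m ms; apply: eqo => //.
    by apply: contraNneq nout => <-.
  by rewrite !E // -mulrDl subrK mul1r.
rewrite !(big_rem n nin) /= !ltnSn ltnn c1n c0n.
have E c' : (forall m, (m < n)%N -> c m = c' m) ->
    \prod_(m <- rem n (tsupp th)) (if (m < n.+1)%N then twt th (c' m) else mean_wt th m)
    = \prod_(m <- rem n (tsupp th)) (if (m < n)%N then twt th (c m) else mean_wt th m).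
  move=> h; apply: eq_big_seq => m; rewrite mem_rem_uniq // inE => /andP[mn _].
  exact: eqo.
by rewrite !E // !mulrA -mulrDl.
Qed.

Variables (T : seq bool -> seq threat) (beta : nat -> rat).
Hypothesis T_ok : forall h, all (threat_ok (size h)) (T h).
Hypothesis T_le : forall h,
  \sum_(th <- T h) tcost th * \prod_(m <- tsupp th) mean_wt th m
  <= beta (size h).

(** The threats of time [t] are chosen from the first [t] coins alone; later coins change their
    weights, not the list. *)
Definition potential (h : seq bool) : rat :=
  \sum_(m < size h) (~~ nth false h m)%:R +
  \sum_(t < (size h).+1) \sum_(th <- T (take t h))
     tcost th * weight (nth false h) (size h) th.

(** Averaged over coin [n], the potential of the old threats grows by exactly [delta n], the
    expected number of new rejections, so one outcome does no worse. The threats announced next add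
    at most [beta]. *)
Lemma potential_step h : exists b,
  potential (rcons h b) <= potential h + delta (size h) + beta (size h).+1.
Proof.
pose n := size h.
(* The potential after outcome [b], without the threats announced at time [n + 1]. *)
pose old b := \sum_(m < n) (~~ nth false h m)%:R + (~~ b)%:R +
  \sum_(t < n.+1) \sum_(th <- T (take t h))
     tcost th * weight (nth false (rcons h b)) n.+1 th.
have nthE b m : (m < n)%N -> nth false h m = nth false (rcons h b) m.
  by move=> mn; rewrite nth_rcons mn.
have potE b : potential (rcons h b) <= old b + beta n.+1.
  rewrite /potential size_rcons -/n [in leLHS]big_ord_recr /=.
  rewrite [X in _ + X]big_ord_recr /= nth_rcons ltnn eqxx /old -!addrA.
  rewrite lerD //; first by rewrite le_eqVlt; apply/orP; left; apply/eqP;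
    apply: eq_bigr => m _; rewrite -nthE.
  rewrite lerD // lerD //.
    rewrite le_eqVlt; apply/orP; left; apply/eqP; apply: eq_bigr => t _ /=.
    by rewrite -cats1 takel_cat // -ltnS.
  rewrite take_oversize ?size_rcons //.
  have := T_le (rcons h b); rewrite size_rcons; apply: le_trans.
  have okT : all (threat_ok n.+1) (T (rcons h b)).
    by have := T_ok (rcons h b); rewrite size_rcons.
  rewrite le_eqVlt; apply/orP; left; apply/eqP; apply: eq_big_seq => th thT.
  by rewrite weight_start //; apply: (allP okT).
have avg : (1 - delta n) * old true + delta n * old false =
    potential h + delta n.
  rewrite /potential -/n /old !mulrDr /=.
  have -> : \sum_(t < n.+1) \sum_(th <- T (take t h)) tcost th *
      weight (nth false h) n th =
    (1 - delta n) * (\sum_(t < n.+1) \sum_(th <- T (take t h)) tcost th *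
      weight (nth false (rcons h true)) n.+1 th) +
    delta n * (\sum_(t < n.+1) \sum_(th <- T (take t h)) tcost th *
      weight (nth false (rcons h false)) n.+1 th).
    rewrite !mulr_sumr -big_split /=; apply: eq_bigr => t _.
    rewrite !mulr_sumr -big_split /=; apply: eq_big_seq => th thT.
    have ok : threat_ok (size (take t h)) th by exact: (allP (T_ok _)) thT.
    rewrite -(@weight_mean (nth false h) (nth false (rcons h true))
      (nth false (rcons h false)) _ _ _ ok); first by ring.
    - by move=> m; exact: nthE.
    - by move=> m; exact: nthE.
    - by rewrite nth_rcons ltnn eqxx.
    - by rewrite nth_rcons ltnn eqxx.
  ring.
have /andP[d0 d1] := delta01 n.
have [le1|lt1] := leP (old true) (potential h + delta n).
  by exists true; apply: le_trans (potE _) _; rewrite lerD2r.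
have [le0|lt0] := leP (old false) (potential h + delta n).
  by exists false; apply: le_trans (potE _) _; rewrite lerD2r.
exfalso; set p := potential h + delta n in avg lt1 lt0.
have a1 : 0 <= (1 - delta n) * (old true - p) by rewrite mulr_ge0 ?subr_ge0 // ltW.
have a0 : 0 <= delta n * (old false - p) by rewrite mulr_ge0 ?subr_ge0 // ltW.
(* Both outcomes exceed their weighted mean. The contradiction comes from the rejecting outcome if
   it has positive probability, otherwise from the accepting one. *)
have [d_gt|d_le] := ltP 0 (delta n).
  have : 0 < delta n * (old false - p) by rewrite mulr_gt0 ?subr_gt0.
  by move: avg a1; clear; nra.
have d_eq : delta n = 0 by apply: le_anti; rewrite d_le d0.
by move: avg lt1; rewrite d_eq subr0 mul1r mul0r addr0 => ->; rewrite ltxx.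
Qed.

Lemma derandomization : exists c : nat -> bool, forall n,
  \sum_(m < n) (~~ c m)%:R +
  \sum_(t < n.+1) \sum_(th <- T (mkseq c t)) tcost th * weight c n th
  <= \sum_(m < n) delta m + \sum_(t < n.+1) beta t.
Proof.
pose bit h := potential (rcons h true) <=
  potential h + delta (size h) + beta (size h).+1.
have bitP h : potential (rcons h (bit h)) <=
    potential h + delta (size h) + beta (size h).+1.
  case E : (bit h) => //; have [[] le_h] := potential_step h => //.
  by rewrite /bit le_h in E.
pose hist := fix hist n :=
  if n is n'.+1 then rcons (hist n') (bit (hist n')) else [::].
pose c n := bit (hist n).
have histE n : hist n = mkseq c n.
  by elim: n => //= n IHn; rewrite mkseqS -IHn.
have potE n : potential (mkseq c n) =
    \sum_(m < n) (~~ c m)%:R +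
    \sum_(t < n.+1) \sum_(th <- T (mkseq c t)) tcost th * weight c n th.
  rewrite /potential size_mkseq; congr (_ + _).
    by apply: eq_bigr => m _; rewrite nth_mkseq.
  apply: eq_bigr => t _.
  have -> : take t (mkseq c n) = mkseq c t.
    by rewrite /mkseq -map_take take_iota (minn_idPl _) // -ltnS.
  apply: eq_bigr => th _; congr (_ * _); apply: weight_eq => m mn.
  by rewrite nth_mkseq.
exists c => n; rewrite -potE; elim: n => [|n IHn].
  rewrite potE !big_ord0 !add0r !big_ord_recl !big_ord0 !addr0 /=.
  apply: le_trans (T_le [::]).
  rewrite le_eqVlt; apply/orP; left; apply/eqP; apply: eq_big_seq => th thT.
  by rewrite (@weight_start c 0) //; apply: (allP (T_ok [::])).
rewrite -histE /= histE; apply: le_trans (bitP _) _.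
rewrite size_mkseq [in leRHS]big_ord_recr /= [X in _ <= _ + X]big_ord_recr /=.
by move: IHn; clear; lra.
Qed.

End Derandomization.

(** * Scales and clashing blocks *)

Lemma scale_exists n : exists s, n < 2 ^ (s.+1 ^ 4).
Proof.
exists n; apply: leq_trans (ltn_expl n (ltnSn 1)) _; rewrite leq_exp2l //.
by apply: leq_trans (leqnSn n) _; rewrite -{1}[n.+1]expn1 leq_pexp2l.
Qed.

Definition scale n := ex_minn (scale_exists n).

Lemma scale_lt n : n < 2 ^ ((scale n).+1 ^ 4).
Proof. by rewrite /scale; case: ex_minnP. Qed.

Lemma scale_min n s : n < 2 ^ (s.+1 ^ 4) -> scale n <= s.
Proof. by rewrite /scale; case: ex_minnP => m _ h /h. Qed.

Lemma scale_ge s n : 2 ^ (s ^ 4) <= n -> s <= scale n.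
Proof.
move=> sn; rewrite leqNgt; apply/negP => lt_s.
have : 2 ^ ((scale n).+1 ^ 4) <= n.
  by apply: leq_trans sn; rewrite leq_exp2l // leq_exp2r.
by rewrite leqNgt scale_lt.
Qed.

Lemma scale_leq_exp n : 0 < scale n -> 2 ^ (scale n ^ 4) <= n.
Proof.
case E : (scale n) => [//|s] _; rewrite leqNgt; apply/negP => /scale_min.
by rewrite E ltnn.
Qed.

Lemma scale_mono m n : m <= n -> scale m <= scale n.
Proof. by move=> mn; apply: scale_min; apply: leq_ltn_trans mn (scale_lt n). Qed.

Lemma scale_double n : scale (2 * n) <= (scale n).+1.
Proof.
apply: scale_min; apply: (@leq_trans (2 * 2 ^ ((scale n).+1 ^ 4))).
  by rewrite ltn_mul2l /= scale_lt.
by rewrite -expnS leq_exp2l // ltn_exp2r.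
Qed.

(** Taking the scale of [2 * n] makes the large prime of [n] exceed the window length [2 ^ scale y]
    of every [y] up to [2 * n]. *)
Definition rough n := ~~ smooth (2 ^ scale (2 * n)) n.

Definition block (B : seq nat) i k := \prod_(a < k) nth 0 B (i + a).

(* I = B[i, i + k) against J = the last r elements of B followed by y. *)
Definition clash (B : seq nat) y i k r :=
  [&& 0 < k, i + k + r <= size B & block B i k == block B (size B - r) r * y].

Definition forced (B : seq nat) y :=
  [exists i : 'I_(size B).+1, exists k : 'I_(size B).+1,
    exists r : 'I_(size B).+1, clash B y i k r].

Lemma forcedP B y : reflect (exists i k r, clash B y i k r) (forced B y).
Proof.
apply: (iffP idP) => [/existsP[i /existsP[k /existsP[r h]]]|[i [k [r h]]]].
  by exists i, k, r.
have /and3P[k0 sz _] := h.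
have i1 : i < (size B).+1 by lia.
have k1 : k < (size B).+1 by lia.
have r1 : r < (size B).+1 by lia.
apply/existsP; exists (Ordinal i1); apply/existsP; exists (Ordinal k1).
by apply/existsP; exists (Ordinal r1).
Qed.

Lemma block_le B i k m :
  (forall a, i <= a < i + k -> nth 0 B a <= m) -> block B i k <= m ^ k.
Proof.
move=> h; have := prod_nat_const 'I_k m; rewrite card_ord => <-.
by apply: leq_prod => a _; apply: h; have := ltn_ord a; lia.
Qed.

Lemma block_ge B i k m :
  (forall a, i <= a < i + k -> m <= nth 0 B a) -> m ^ k <= block B i k.
Proof.
move=> h; have := prod_nat_const 'I_k m; rewrite card_ord => <-.
by apply: leq_prod => a _; apply: h; have := ltn_ord a; lia.
Qed.

Lemma block_shift_le B B' i i' k :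
  (forall a, a < k -> nth 0 B (i + a) <= nth 0 B' (i' + a)) ->
  block B i k <= block B' i' k.
Proof. by move=> h; apply: leq_prod => a _; exact: h. Qed.

(** Each factor grows by a ratio of at least [1 + e a / Y], and the product of these ratios is at
    least 1 plus the sum of the [e a / Y]. *)
Lemma prod_shift_ge (k Y : nat) (d e : nat -> nat) :
  (forall a, a < k -> d a <= Y) ->
  (\prod_(a < k) d a) * (Y + \sum_(a < k) e a) <= (\prod_(a < k) (d a + e a)) * Y.
Proof.
elim: k => [|k IHk] h; first by rewrite !big_ord0 addn0.
rewrite !big_ord_recr /=.
have {}IHk := IHk (fun a ak => h a (ltnW ak)).
have := h k (ltnSn k); move: IHk.
move: (\prod_(i < k) d i) (\prod_(i < k) (d i + e i)) (\sum_(i < k) e i) => P Q S IH dk.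
apply: (@leq_trans (P * (Y + S) * (d k + e k))); last first.
  by rewrite [X in _ <= X]mulnAC leq_mul2r IH orbT.
rewrite -!mulnA leq_mul2l; apply/orP; right.
nia.
Qed.

Section Increasing.

Variables (B : seq nat) (y : nat).
Hypothesis B_sorted : sorted ltn B.
Hypothesis B_bound : forall m, m \in B -> 2 <= m < y.

Lemma nth_gap a b : a <= b < size B -> nth 0 B a + (b - a) <= nth 0 B b.
Proof using B_sorted.
case/andP; elim: b => [|b IHb]; first by rewrite leqn0 => /eqP -> _; rewrite addn0.
rewrite leq_eqVlt => /orP[/eqP -> _|ab bB]; first by rewrite subnn addn0.
have {}IHb := IHb ab (ltnW bB).
have : nth 0 B b < nth 0 B b.+1.
  apply: (sorted_ltn_nth ltn_trans 0 B_sorted) => //; rewrite inE //; exact: ltnW.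
lia.
Qed.

Lemma nth_bound a : a < size B -> 2 <= nth 0 B a < y.
Proof using B_bound. by move=> aB; apply: B_bound; rewrite mem_nth. Qed.

Lemma block_gt0 i k : i + k <= size B -> 0 < block B i k.
Proof using B_sorted B_bound.
move=> h; apply: prodn_gt0 => a; have := ltn_ord a => ak.
by have /andP[] := @nth_bound (i + a) ltac:(lia); lia.
Qed.

(** All of I lies below all of J. With [m] the largest element of I, [k <= r + 1] would give a
    product of I at most [m ^ k], hence less than [(m + 1) ^ (r + 1)], which J attains. *)
Lemma clash_rest_lt i k r : clash B y i k r -> r.+1 < k.
Proof using B_sorted B_bound.
case/and3P=> k0 sz /eqP E; rewrite ltnNge; apply/negP => kr.
pose m := nth 0 B (i + k).-1.
have upper : block B i k <= m ^ k.
  by apply: block_le => a ak; have := @nth_gap a (i + k).-1; rewrite -/m; lia.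
have lower : m.+1 ^ r <= block B (size B - r) r.
  apply: block_ge => a ak; have := @nth_gap (i + k).-1 a; rewrite -/m; lia.
have my : m < y by have := @nth_bound (i + k).-1 ltac:(lia); rewrite -/m; lia.
have : m.+1 ^ r.+1 <= block B i k by rewrite E expnSr leq_mul.
have : m ^ k < m.+1 ^ k by rewrite ltn_exp2r.
have : m.+1 ^ k <= m.+1 ^ r.+1 by rewrite leq_pexp2l.
lia.
Qed.

Lemma clash_size i k r : clash B y i k r -> block B i k <= y ^ r.+1.
Proof using B_sorted B_bound.
case/and3P=> k0 sz /eqP ->; rewrite expnSr leq_mul2r; apply/orP; right.
apply: block_le => a ar; have := @nth_bound a ltac:(lia); lia.
Qed.

Lemma clash_length i k r L : y < 2 ^ L -> clash B y i k r -> k < L * r.+1.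
Proof using B_sorted B_bound.
move=> yL cl; have := clash_size _ _ _ cl; case/and3P: cl => k0 sz _ up.
have : 2 ^ k <= block B i k.
  by apply: block_ge => a ak; have := @nth_bound a ltac:(lia); lia.
move=> /leq_trans/(_ up) h; rewrite -(@ltn_exp2l 2) // expnM.
by apply: leq_ltn_trans h _; rewrite ltn_exp2r.
Qed.

(** As [k >= r + 2], the first element of I is at most [y ^ ((r + 1) / (r + 2))]; this makes short
    clashes rare. *)
Lemma clash_first i k r : clash B y i k r -> nth 0 B i ^ k <= y ^ r.+1.
Proof using B_sorted B_bound.
move=> cl; apply: leq_trans (clash_size _ _ _ cl); case/and3P: cl => k0 sz _.
by apply: block_ge => a ak; have := @nth_gap i a ltac:(lia); lia.
Qed.

(** The two tails J differ only in their last element, so the products of the two blocks I are in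
    the ratio [y2 / y]. This puts the second block to the right. If the blocks were disjoint,
    [prod_shift_ge] would bound the total displacement by [y2 - y < H]. *)
Lemma clash_close y2 i1 i2 k r H : y < y2 < y + H -> H * H <= y ->
  (0 < r -> exists p, [/\ prime p, p %| last 0 B & 2 * H < p]) ->
  clash B y i1 k r -> clash B y2 i2 k r -> i1 < i2 < i1 + k.
Proof using B_sorted B_bound.
move=> yy2 HH hp cl1 cl2; have rk := clash_rest_lt _ _ _ cl1.
case/and3P: cl1 => k0 s1 /eqP E1; case/and3P: cl2 => _ s2 /eqP E2.
have cross : block B i2 k * y = block B i1 k * y2.
  by rewrite E1 E2 mulnAC.
have pos1 : 0 < block B i1 k by apply: block_gt0; lia.
have i12 : i1 < i2.
  rewrite ltnNge; apply/negP => i21.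
  have le21 : block B i2 k <= block B i1 k.
    by apply: block_shift_le => a ak; have := @nth_gap (i2 + a) (i1 + a); lia.
  have : block B i1 k * y < block B i1 k * y2 by rewrite ltn_mul2l pos1; lia.
  by rewrite -cross ltn_mul2r; lia.
rewrite i12 /= ltnNge; apply/negP => i1k.
pose d a := nth 0 B (i1 + a); pose e a := nth 0 B (i2 + a) - nth 0 B (i1 + a).
have deE a : a < k -> nth 0 B (i2 + a) = d a + e a.
  by move=> ak; have := @nth_gap (i1 + a) (i2 + a); rewrite /d /e; lia.
have eH : \sum_(a < k) e a < H.
  have : block B i1 k * (y + \sum_(a < k) e a) <= block B i1 k * y2.
    rewrite -cross; have -> : block B i2 k = \prod_(a < k) (d a + e a).
      by apply: eq_bigr => a _; apply: deE.
    apply: (prod_shift_ge k y d e) => a ak.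
    by have := @nth_bound (i1 + a) ltac:(lia); rewrite /d; lia.
  by rewrite leq_mul2l; lia.
have eaH a : a < k -> e a < H.
  by move=> ak; apply: leq_ltn_trans eH; rewrite (bigD1 (Ordinal ak)) //= leq_addr.
(* For [r > 0] the prime [p] of the last element of [B] divides both tails, hence an element of each
   block I. Two displacements below [H] put these distinct multiples of [p] within [2 * H] of each
   other. *)
case: (posnP r) => [r0|r0]; last first.
  have [p [pp plast pH]] := hp r0.
  have pr : p %| block B (size B - r) r.
    move: plast; rewrite -nth_last /block -[r]prednK // big_ord_recr /= prednK //.
    have -> : size B - r + r.-1 = (size B).-1 by lia.
    by move=> h; rewrite dvdn_mull.
  have fact i : p %| block B i k -> exists2 a, a < k & p %| nth 0 B (i + a).
    rewrite /block; elim: (k) => [|k' IH]; first by rewrite big_ord0 (gtnNdvd _ (prime_gt1 pp)).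
    rewrite big_ord_recr /= Euclid_dvdM // => /orP[/IH[a ak pa]|pa].
      by exists a => //; lia.
    by exists k'.
  have [a1 a1k pa1] : exists2 a, a < k & p %| nth 0 B (i1 + a).
    by apply: fact; rewrite E1 dvdn_mulr.
  have [a2 a2k pa2] : exists2 a, a < k & p %| nth 0 B (i2 + a).
    by apply: fact; rewrite E2 dvdn_mulr.
  have sz : i2 + k <= size B by move: s2; clear; lia.
  have gap a b : a <= b < i2 + k -> nth 0 B a + (b - a) <= nth 0 B b.
    by case/andP=> ab bk; apply: nth_gap; rewrite ab (leq_trans bk).
  have pd : p %| nth 0 B (i2 + a2) - nth 0 B (i1 + a1) by rewrite dvdn_sub.
  have lt12 : i1 + a1 < i2 + a2 by move: a1k i1k; clear; lia.
  have g1 := gap (i1 + a1) (i2 + a2) ltac:(move: a2k lt12; clear; lia).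
  have {pd} ple : p <= nth 0 B (i2 + a2) - nth 0 B (i1 + a1).
    by apply: dvdn_leq pd; move: lt12 g1; clear; lia.
  have g2 := gap (i2 + a2) (i2 + k.-1) ltac:(move: a2k; clear; lia).
  have g3 := gap i1 (i1 + a1) ltac:(move: a1k i1k; clear; lia).
  have g4 := gap (i1 + k.-1) i2 ltac:(move: k0 i1k; clear; lia).
  have e1 := deE 0 k0; have e2 := deE k.-1 ltac:(move: k0; clear; lia).
  have h1 := eaH 0 k0; have h2 := eaH k.-1 ltac:(move: k0; clear; lia).
  move: ple g2 g3 g4 e1 e2 h1 h2 pH; rewrite /d !addn0; clear; lia.
(* For [r = 0] the blocks multiply to [y] and [y2]. With [R] the product of the first block without
   its first element, moving right adds at least [R], so [R < H]; but the first element is below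
   [R], so [y < H * H]. *)
have b0 : block B (size B - r) r = 1 by rewrite r0 /block big_ord0.
rewrite b0 !mul1n in E1 E2.
have kS : k = k.-1.+1 by lia.
pose R := \prod_(a < k.-1) nth 0 B (i1 + a.+1).
have b1 : block B i1 k = nth 0 B i1 * R.
  by rewrite {1}/block kS big_ord_recl addn0.
have b2 : (nth 0 B i1).+1 * R <= block B i2 k.
  rewrite /block kS big_ord_recl addn0 leq_mul //=.
      have := @nth_gap i1 i2 ltac:(move: i12 s2 k0; clear; lia); move: i12; clear; lia.
  apply: leq_prod => a _; have := ltn_ord a.
  have := @nth_gap (i1 + a.+1) (i2 + a.+1); rewrite /bump /= ?add1n.
  have := ltn_ord a; move: i12 s2 k0; clear; lia.
have R1 : nth 0 B i1 < R.
  have kS2 : k.-1 = k.-2.+1 by move: rk; rewrite r0; clear; lia.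
  rewrite /R kS2 big_ord_recl /=; apply: (@leq_trans (nth 0 B (i1 + 1) * 1)).
    rewrite muln1; have := @nth_gap i1 (i1 + 1); move: s1 rk; clear; lia.
  rewrite leq_mul //; apply: prodn_gt0 => a; have := ltn_ord a => ak.
  have := @nth_bound (i1 + (bump 0 a).+1); rewrite /bump.
  by move: ak kS2 kS s1; clear; lia.
rewrite E1 in b1; rewrite E2 in b2.
have RH : R < H by move: b1 b2 yy2; clear; nia.
by move: b1 R1 RH HH; clear; nia.
Qed.

End Increasing.

(** * The greedy sequence *)

Fixpoint elts (n0 : nat) (c : nat -> bool) (n : nat) : seq nat :=
  if n is m.+1 then
    let B := elts n0 c m in
    if [&& n0 <= m, c m, rough m & ~~ forced B m] then rcons B m else B
  else [::].

Definition admitted n0 c n :=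
  [&& n0 <= n, c n, rough n & ~~ forced (elts n0 c n) n].

Lemma elts_filter n0 c n : elts n0 c n = seq.filter (admitted n0 c) (iota 0 n).
Proof.
elim: n => [//|n IHn]; rewrite -[in RHS]addn1 iotaD filter_cat -IHn /= -/(admitted n0 c n).
by case: ifP; rewrite ?cats1 ?cats0.
Qed.

Lemma elts_ext n0 c c' n : (forall m, m < n -> c m = c' m) ->
  elts n0 c n = elts n0 c' n.
Proof.
elim: n => //= n IHn h; rewrite IHn; last by move=> m mn; rewrite h // ltnW.
by rewrite h.
Qed.

(** Counting by fingerprints: each entry of [fs] is a statistic with its strict upper bound, and
    together the statistics separate the points of [F]. *)
Lemma size_le_prod (T : eqType) (F : seq T) (fs : seq ((T -> nat) * nat)) : uniq F ->
  (forall n, n \in F -> all (fun fb => fb.1 n < fb.2) fs) ->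
  (forall m n, m \in F -> n \in F -> all (fun fb => fb.1 m == fb.1 n) fs -> m = n) ->
  size F <= \prod_(fb <- fs) fb.2.
Proof.
elim: fs F => [|[f b] fs IHfs] F uF bF iF.
  rewrite big_nil; case: F uF bF iF => // m [//|n F] /= /andP[mF _] _ iF.
  by move: mF; rewrite (iF m n) ?inE ?eqxx ?orbT.
rewrite big_cons /=; set X := \prod_(_ <- _) _.
have part v : size (seq.filter (fun n => f n == v) F) <= X.
  apply: IHfs; first exact: filter_uniq.
    by move=> n; rewrite mem_filter => /andP[_ /bF /= /andP[]].
  move=> m n; rewrite !mem_filter => /andP[/eqP fm mF] /andP[/eqP fn nF] h.
  by apply: iF => //=; rewrite fm fn eqxx.
have {}bF n : n \in F -> f n < b by move=> /bF /= /andP[].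
elim: b F uF {iF IHfs} part bF => [|b IHb] F uF part bF.
  by case: F bF {part uF} => // n F /(_ n); rewrite mem_head => /(_ isT).
rewrite -(count_predC (fun n => f n == b) F) mulSn leq_add //.
  by rewrite -size_filter.
rewrite -size_filter; apply: IHb; first exact: filter_uniq.
  move=> v; apply: leq_trans (part v); rewrite !size_filter count_filter.
  by apply: sub_count => n /= /andP[].
move=> n; rewrite mem_filter /= => /andP[fn /bF]; rewrite ltnS leq_eqVlt.
by rewrite (negbTE fn).
Qed.

Lemma count_cover4 (P1 P2 P3 P4 : pred nat) (s : seq nat) :
  (forall n, n \in s -> [|| P1 n, P2 n, P3 n | P4 n]) ->
  size s <= count P1 s + (count P2 s + (count P3 s + count P4 s)).
Proof.
elim: s => //= n s IHs h.
have {}IHs : size s <= count P1 s + (count P2 s + (count P3 s + count P4 s)).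
  by apply: IHs => m ms; apply: h; rewrite inE ms orbT.
have := h n (mem_head _ _); move: IHs; clear.
case: (P1 n); case: (P2 n); case: (P3 n); case: (P4 n) => //=; lia.
Qed.

Definition witness (B : seq nat) y : nat * nat * nat :=
  if [pick t : 'I_(size B).+1 * 'I_(size B).+1 * 'I_(size B).+1
       | clash B y t.1.1 t.1.2 t.2] is Some t
  then (val t.1.1, val t.1.2, val t.2) else (0, 0, 0).

Lemma witnessP B y : forced B y ->
  clash B y (witness B y).1.1 (witness B y).1.2 (witness B y).2.
Proof.
case/existsP=> i /existsP[k /existsP[r h]].
by rewrite /witness; case: pickP => [t //|/(_ (i, k, r))]; rewrite h.
Qed.

(* For s = scale y: y < 2 ^ len_bound s; clashes with r < short_max s are counted,
   those with r >= long_min s never occur, and first_bound s bounds k for the others. *)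
Definition len_bound s := s.+1 ^ 4.
Definition short_max s := s ^ 3 - s.
Definition long_min s := 8 * s * len_bound s.
Definition first_bound s := len_bound s * (long_min s).+1.

Lemma len_bound_mono s s' : s <= s' -> len_bound s <= len_bound s'.
Proof. by move=> h; rewrite leq_exp2r. Qed.

Lemma long_min_mono s s' : s <= s' -> long_min s <= long_min s'.
Proof. by move=> h; rewrite leq_mul ?len_bound_mono // leq_mul. Qed.

Lemma first_bound_mono s s' : s <= s' -> first_bound s <= first_bound s'.
Proof. by move=> h; rewrite leq_mul ?len_bound_mono // ltnS long_min_mono. Qed.

Lemma long_min_gt0 s : 0 < s -> 0 < long_min s.
Proof. by move=> s_gt0; rewrite /long_min muln_gt0 expn_gt0 muln_gt0 s_gt0. Qed.

Lemma fact_le_exp n : n`! <= n ^ n.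
Proof.
elim: n => // n IHn; rewrite factS expnS leq_mul2l /=.
by apply: leq_trans IHn _; case: n => // n; rewrite leq_exp2r.
Qed.

Lemma exp4_ge s : 4 <= s -> 64 * s <= s ^ 4.
Proof.
move=> s4; rewrite expnSr leq_mul2r; apply/orP; right.
by have := @leq_exp2r 4 s 3 isT; rewrite s4 => ->.
Qed.

(** * Windows of the greedy sequence contain many elements *)

Section Sequence.

Variables (n0 : nat) (c : nat -> bool).
Hypothesis n0_ge2 : 2 <= n0.

Local Notation elts := (elts n0 c).
Local Notation admitted := (admitted n0 c).

Lemma elts_cat n n' : n <= n' ->
  elts n' = elts n ++ seq.filter admitted (iota n (n' - n)).
Proof. by move=> h; rewrite !elts_filter -filter_cat -iotaD subnKC. Qed.

Lemma elts_sorted n : sorted ltn (elts n).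
Proof. by rewrite elts_filter sorted_filter ?iota_ltn_sorted //; exact: ltn_trans. Qed.

Lemma elts_memE n m : (m \in elts n) = (m < n) && admitted m.
Proof. by rewrite elts_filter mem_filter mem_iota andbC. Qed.

Lemma elts_bound n m : m \in elts n -> 2 <= m < n.
Proof.
rewrite elts_memE => /andP[-> /and4P[h _ _ _]]; rewrite andbT.
exact: leq_trans h.
Qed.

Lemma nth_elts n n' a : n <= n' -> a < size (elts n) ->
  nth 0 (elts n') a = nth 0 (elts n) a.
Proof. by move=> /elts_cat -> h; rewrite nth_cat h. Qed.

(** If [y1 < y2], the block I is the same for both, whereas the last [r] elements can only grow with
    time, so the product of J would grow strictly. *)
Lemma clash_determines y1 y2 i k r :
  clash (elts y1) y1 i k r -> clash (elts y2) y2 i k r -> y1 = y2.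
Proof.
wlog: y1 y2 / y1 <= y2 => [hw|y12] cl1 cl2.
  case: (leqP y1 y2) => [|/ltnW] h; first exact: hw h cl1 cl2.
  by apply/esym; exact: hw h cl2 cl1.
apply/eqP; rewrite eqn_leq y12 /= leqNgt; apply/negP => lt12.
case/and3P: cl1 => _ s1 /eqP E1; case/and3P: cl2 => _ s2 /eqP E2.
have sz : size (elts y1) <= size (elts y2) by rewrite (elts_cat _ _ y12) size_cat leq_addr.
have E : block (elts y1) i k = block (elts y2) i k.
  by apply: eq_bigr => a _; rewrite (nth_elts y1 y2) //; have := ltn_ord a; lia.
have le : block (elts y1) (size (elts y1) - r) r <= block (elts y2) (size (elts y2) - r) r.
  apply: block_shift_le => a ar; rewrite -(nth_elts y1 y2) //; last lia.
  have := @nth_gap (elts y2) (elts_sorted _) (size (elts y1) - r + a) (size (elts y2) - r + a); lia.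
have pos : 0 < block (elts y1) (size (elts y1) - r) r.
  by apply: (block_gt0 _ y1 (@elts_sorted y1) (@elts_bound y1)); move: s1; clear; lia.
move: E; rewrite E1 E2; nia.
Qed.

Definition long y := exists i k r,
  clash (elts y) y i k r /\ long_min (scale y) <= r.

Definition populated y := n0 + 2 ^ scale y <= y ->
  long_min (scale y) <= count admitted (iota (y - 2 ^ scale y) (2 ^ scale y)).

Variable s0 : nat.
Hypothesis s0_ge : 4 <= s0.
Hypothesis n0_ge : 2 ^ (s0 ^ 4) <= n0.
Hypothesis s0_count : forall s, s0 <= s ->
  48 * (long_min s + long_min s * (first_bound s * (first_bound s *
    (8 * (long_min s))))) + 208 <= 2 ^ s.

Lemma scale_ge_s0 y : n0 <= y -> s0 <= scale y.
Proof. by move=> h; apply: scale_ge; apply: leq_trans n0_ge h. Qed.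

Lemma window_small y : n0 <= y -> 2 ^ (2 * scale y).+3 <= y.
Proof.
move=> /scale_ge_s0 h; have s4 : 4 <= scale y by apply: leq_trans h.
apply: leq_trans (scale_leq_exp _ (leq_trans _ s4)) => //; rewrite leq_exp2l //.
by have := exp4_ge _ s4; move: s4; clear; lia.
Qed.

(** The last element [q] satisfies [y <= 2 * q], either because the window before [y] is populated
    or because [y] is still close to [n0]. So the prime making [q] rough exceeds [2 ^ scale y]. *)
Lemma last_elts y : n0 <= y -> populated y -> 0 < size (elts y) ->
  exists p, [/\ prime p, p %| last 0 (elts y) & 2 ^ scale y < p].
Proof.
move=> n0y dy sz; set q := last 0 (elts y).
have qE : q \in elts y by rewrite /q -nth_last mem_nth // prednK.
have qmax m : m \in elts y -> m <= q.
  move=> /(nthP 0)[a ay <-]; rewrite /q -nth_last.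
  apply: leq_trans (nth_gap _ (elts_sorted y) a (size (elts y)).-1 _).
    exact: leq_addr.
  by rewrite prednK // leqnn andbT -ltnS prednK.
have ws := window_small _ n0y.
have wl : 2 * 2 ^ scale y <= y.
  by apply: leq_trans ws; rewrite -expnS leq_exp2l //; lia.
have q2 : y <= 2 * q.
  move: (qE); rewrite elts_memE => /andP[_ /and4P[n0q _ _ _]].
  have [h|] := leqP (n0 + 2 ^ scale y) y; last lia.
  have : has admitted (iota (y - 2 ^ scale y) (2 ^ scale y)).
    rewrite has_count; apply: leq_trans (dy h); apply: long_min_gt0.
    by apply: leq_trans (scale_ge_s0 _ n0y); apply: leq_trans s0_ge.
  case/hasP=> m; rewrite mem_iota => hm am.
  have : m <= q by apply: qmax; rewrite elts_memE am; lia.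
  lia.
move: (qE); rewrite elts_memE => /andP[_ /and4P[n0q _ rq _]].
have [p [pp pq Rp]] := smoothPn _ _ (leq_trans (ltnW n0_ge2) n0q) rq.
exists p; split=> //; apply: leq_ltn_trans Rp.
by rewrite leq_exp2l // scale_mono.
Qed.

Lemma populated_step y :
  16 * count (fun n => ~~ c n) (iota (y - 2 ^ scale y) (2 ^ scale y)) <= 2 ^ scale y ->
  (forall y1, n0 <= y1 < y -> rough y1 -> ~ long y1) ->
  (forall y1, n0 <= y1 < y -> populated y1) -> populated y.
Proof.
set s := scale y; set M := 2 ^ s => zeros nolong dens n0My.
rewrite -/s -/M in n0My.
rewrite leqNgt; apply/negP; rewrite -/s -/M => sparse.
have n0y : n0 <= y by lia.
have s0s : s0 <= s by exact: scale_ge_s0.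
have s4 : 4 <= s by exact: leq_trans s0s.
have ws := window_small y n0y; rewrite -/s in ws.
have M1 : 0 < M by rewrite expn_gt0.
have M8 : M = 8 * 2 ^ (s - 3) by rewrite -(expnD 2 3) subnKC //; lia.
have My : 8 * (M * M) <= y.
  by apply: leq_trans ws; rewrite -[(2 * s).+3]addn3 expnD mul2n -addnn expnD mulnC.
pose F := seq.filter (fun n => rough n && forced (elts n) n) (iota (y - M) M).
have cover : M <= count admitted (iota (y - M) M) +
    (count (fun n => ~~ c n) (iota (y - M) M) +
    (count (smooth (2 ^ s.+1)) (iota (y - M) M) + size F)).
  rewrite /F size_filter -{1}(size_iota (y - M) M); apply: count_cover4 => n.
  rewrite mem_iota => /andP[yn ny]; rewrite /admitted.
  have n0n : n0 <= n by move: yn n0My; clear; lia.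
  have sm : smooth (2 ^ scale (2 * n)) n -> smooth (2 ^ s.+1) n.
    apply: sub_all => p h; apply: leq_trans h _; rewrite leq_exp2l //.
    apply: leq_trans (scale_double n) _; rewrite ltnS; apply: scale_mono.
    by move: ny My M1; clear; nia.
  rewrite n0n /= /rough; case: (c n) => //=.
  by case: (smooth _ n) sm => /= [->|_] //; case: forced; rewrite ?orbT.
(* Primes up to [2 * M] give [(2 * M + 13) / 3]. The exponent [e] is at most [M / 16], since
   [y - M >= 2 ^ (s ^ 4 - 1)] while [M! <= M ^ M = 2 ^ (s * M)]. *)
have smc : 48 * count (smooth (2 ^ s.+1)) (iota (y - M) M) <= 35 * M + 208.
  have t0 : 0 < y - M by nia.
  have [e le_e fe] := smooth_count (y - M) M (2 ^ s.+1) t0.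
  have := count_prime_iota (2 ^ s.+1).+1; rewrite expnS -/M.
  have : 16 * e <= M.
    have te : 2 ^ ((s ^ 4).-1 * e) <= 2 ^ (s * M).
      rewrite !expnM -/M; apply: leq_trans (leq_trans fe (fact_le_exp M)).
      have [->//|e0] := posnP e; rewrite leq_exp2r //.
      have : 2 ^ (s ^ 4) <= y by apply: scale_leq_exp; rewrite -/s; lia.
      have -> : 2 ^ (s ^ 4) = 2 * 2 ^ (s ^ 4).-1.
        by rewrite -expnS prednK // expn_gt0; lia.
      have : M <= M * M by move: M1; clear; nia.
      by move: My; clear; lia.
    move: te; rewrite leq_exp2l // => te.
    have : 16 * s <= (s ^ 4).-1 by have := exp4_ge _ s4; move: s4; clear; lia.
    by move: te s4; clear; nia.
  move: le_e; rewrite expnS -/M; lia.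
have szF : size F <= long_min s * (first_bound s * (first_bound s * (8 * (long_min s)))).
  pose w n := witness (elts n) n.
  pose fs : seq ((nat -> nat) * nat) :=
    [:: ((fun n => (w n).2), long_min s);
        ((fun n => (w n).1.2), first_bound s);
        ((fun n => (w n).1.1 %% (w n).1.2), first_bound s);
        ((fun n => (n - (y - M)) %/ 2 ^ (s - 3)), 8);
        ((fun n => count admitted (iota (y - M) (n - (y - M)))), long_min s)].
  have Fin n : n \in F -> [/\ n0 <= n, y - M <= n < y, scale n <= s,
      rough n & clash (elts n) n (w n).1.1 (w n).1.2 (w n).2].
    rewrite mem_filter mem_iota => /andP[/andP[rn /witnessP fn] nM].
    split=> //; [lia|lia|apply: scale_mono; lia].
  have bnd n : n \in F -> (w n).2 < long_min s /\ (w n).1.2 < first_bound s.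
    move=> /Fin[n0n nM sn rn cl].
    have rl : (w n).2 < long_min (scale n).
      rewrite ltnNge; apply/negP => h; apply: (nolong n) => //; first lia.
      by exists (w n).1.1, (w n).1.2, (w n).2.
    split; first by apply: leq_trans rl (long_min_mono _ _ sn).
    apply: leq_trans (clash_length _ n (@elts_sorted n) (@elts_bound n) _ _ _ _ (scale_lt n) cl) _.
    apply: leq_mul; first exact: len_bound_mono.
    by rewrite ltnS; apply: leq_trans (ltnW rl) (long_min_mono _ _ sn).
  have <- : \prod_(fb <- fs) fb.2 = long_min s * (first_bound s *
      (first_bound s * (8 * long_min s))).
    by rewrite !big_cons big_nil /= muln1.
  apply: size_le_prod.
  - by rewrite filter_uniq // iota_uniq.
  - move=> n nF; have [b1 b2] := bnd n nF; have [n0n nM sn rn cl] := Fin n nF.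
    rewrite /= b1 b2 /= ltn_divLR ?expn_gt0 // -M8 andbT.
    apply/and3P; split; [|lia|].
      by apply: leq_ltn_trans b2; case/and3P: cl => k0 _ _; apply/ltnW/ltn_pmod.
    apply: leq_ltn_trans sparse.
    have -> : iota (y - M) M = iota (y - M) (n - (y - M)) ++
        iota (y - M + (n - (y - M))) (y - n).
      by rewrite -iotaD; congr iota; move: nM n0My; clear; lia.
    by rewrite count_cat leq_addr.
  - have main m n : m \in F -> n \in F -> m < n ->
      all (fun fb => fb.1 m == fb.1 n) fs -> False.
      move=> mF nF mn; have [n0m mM sm rm clm] := Fin m mF; have [n0n nM sn rn cln] := Fin n nF.
      rewrite /= andbT => /and5P[/eqP r12 /eqP k12 /eqP i12 /eqP d12 /eqP c12].
      have eB : elts n = elts m.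
        rewrite (elts_cat _ _ (ltnW mn)).
        have /eqP : count admitted (iota m (n - m)) = 0.
          have en : n - (y - M) = (m - (y - M)) + (n - m).
            by move: mn mM; clear; lia.
          have em : y - M + (m - (y - M)) = m by move: mM; clear; lia.
          move: c12; rewrite en iotaD count_cat em.
          by rewrite -{1}[count _ _]addn0 => /addnI/esym.
        by rewrite -size_filter => /nilP ->; rewrite cats0.
      move: cln; rewrite eB -r12 -k12 => cln.
      have H0 : 0 < 2 ^ (s - 3) by rewrite expn_gt0.
      have mn' : m < n < m + 2 ^ (s - 3).
        rewrite mn /=; have := divn_eq (m - (y - M)) (2 ^ (s - 3)).
        have := divn_eq (n - (y - M)) (2 ^ (s - 3)); rewrite d12.
        have := ltn_pmod (n - (y - M)) H0; move: mM nM; clear; lia.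
      have Hm : 2 ^ (s - 3) * 2 ^ (s - 3) <= m.
        by move: M8 My mM H0 M1; move: (2 ^ (s - 3)) => H; clear; nia.
      have hp : 0 < (w m).2 -> exists p, [/\ prime p, p %| last 0 (elts m) & 2 * 2 ^ (s - 3) < p].
        move=> r0; have dm : populated m by apply: dens; move: n0m mM; clear; lia.
        have szm : 0 < size (elts m).
          by case/and3P: clm => _ + _; move: r0; clear; lia.
        have [p [pp pl sp]] := last_elts m n0m dm szm.
        exists p; split=> //; apply: leq_ltn_trans sp; rewrite -expnS leq_exp2l //.
        suff : s <= (scale m).+1 by move: s4; clear; lia.
        by apply: leq_trans (scale_double m); apply: scale_mono; move: mM My M1; clear; nia.
      have /andP[ii ik] := @clash_close _ m (elts_sorted m) (@elts_bound m)
        n _ _ _ _ _ mn' Hm hp clm cln.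
      move: i12; rewrite -k12; move: ii ik.
      case/and3P: clm => k0 _ _.
      move: (w m).1.1 (w m).1.2 (w n).1.1 k0 => i1 k i2 k0 ii ik i12.
      have : k %| i2 - i1 by rewrite -eqn_mod_dvd ?i12 // ltnW.
      move/dvdn_leq; rewrite subn_gt0 ii => /(_ isT).
      by move: ik ii; clear; lia.
    move=> m n mF nF h; case: (ltngtP m n) => // mn; first by case: (main _ _ mF nF mn h).
    suff h' : all (fun fb => fb.1 n == fb.1 m) fs by case: (main _ _ nF mF mn h').
    by rewrite -(eq_all (a1 := fun fb => fb.1 m == fb.1 n)) // => fb; exact: eq_sym.
have := s0_count s s0s; rewrite -/M; move: cover smc szF zeros sparse; clear; lia.
Qed.

End Sequence.

(** * Threats *)

(** A decoder: from the product [N] of a tail lying in the window at [t], it recovers the elements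
    of the tail by their large primes. *)
Definition fiber (t N : nat) : seq nat :=
  [seq n <- iota t (2 ^ scale (2 * t)).+1 | rough n &&
     has (fun p => (2 ^ scale (2 * n) < p) && (p %| N)) (primes n)].

(** The last decoded element plays the part of [y]; a clash at [y] requires only the coins of the
    elements before it to have accepted. *)
Definition fiber_body (S : seq nat) := take (size S).-1 S.

Lemma fiber_bound t N n : n \in fiber t N -> t <= n <= t + 2 ^ scale (2 * t).
Proof. by rewrite mem_filter mem_iota addnS ltnS => /andP[]. Qed.

Lemma fiber_sorted t N : sorted ltn (fiber t N).
Proof. by rewrite sorted_filter ?iota_ltn_sorted //; exact: ltn_trans. Qed.

Lemma fiber_last t N : t <= last t (fiber t N) <= t + 2 ^ scale (2 * t).
Proof.
have := fiber_bound t N; case: (fiber t N) => [|n S] h; first by rewrite leqnn leq_addr.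
exact/h/mem_last.
Qed.

Lemma prime_dvd_prod (p : nat) (s : seq nat) : prime p ->
  p %| \prod_(n <- s) n -> exists2 n, n \in s & p %| n.
Proof.
move=> pp; elim: s => [|a s IHs].
  by rewrite big_nil (gtnNdvd _ (prime_gt1 pp)).
rewrite big_cons Euclid_dvdM // => /orP[pa|/IHs[n ns pn]].
  by exists a; rewrite ?mem_head.
by exists n; rewrite // inE ns orbT.
Qed.

(* Two elements of a window of length 2 ^ scale (2 * t) never share a prime factor
   that witnesses roughness, so a product of rough elements determines its factors. *)
Lemma fiber_prod t S : 0 < t -> sorted ltn S ->
  (forall n, n \in S -> (t <= n <= t + 2 ^ scale (2 * t)) && rough n) ->
  fiber t (\prod_(n <- S) n) = S.
Proof.
move=> t0 sS hS; apply: (irr_sorted_eq ltn_trans ltnn (fiber_sorted _ _) sS) => n.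
rewrite mem_filter mem_iota addnS ltnS; apply/andP/idP.
  case=> /andP[rn /hasP[p]]; rewrite mem_primes => /and3P[pp n0 pn] /andP[Rp pS] nt.
  have [m mS pm] := prime_dvd_prod _ _ pp pS.
  have [//|nm] := eqVneq n m; first by move=> ->.
  have mono : 2 ^ scale (2 * t) <= 2 ^ scale (2 * n).
    by rewrite leq_exp2l // scale_mono // leq_mul2l; case/andP: nt.
  have := hS m mS; case/andP=> mt _.
  have pd : p %| (n - m) + (m - n) by rewrite dvdn_addr dvdn_sub.
  have := dvdn_leq _ pd; move: nm nt mt Rp mono; clear.
  by move: (2 ^ scale (2 * t)) (2 ^ scale (2 * n)) => M1 M2; lia.
move=> nS; have /andP[nt rn] := hS n nS; rewrite nt rn; split=> //=.
have n0 : 0 < n by move: nt t0; clear; lia.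
have [p [pp pn Rp]] := smoothPn _ _ n0 rn.
apply/hasP; exists p; first by rewrite mem_primes pp n0.
by rewrite Rp /= (dvdn_trans pn) // (big_rem n nS) dvdn_mulr.
Qed.

(** Moving a block of elements below [t] by [e] places multiplies its product by at least
    [(1 + e / t) ^ k]. Staying between [t ^ l] and [(t + M) ^ l] with [l <= k] then forces
    [e <= M]. *)
Lemma block_location B t M i1 i2 k l : sorted ltn B ->
  (forall m, m \in B -> 2 <= m < t) -> i1 < i2 -> i2 + k <= size B -> 0 < l <= k ->
  t ^ l <= block B i1 k -> block B i2 k <= (t + M) ^ l -> i2 - i1 <= M.
Proof.
move=> sB bB i12 sz /andP[l0 lk] lo hi; rewrite leqNgt; apply/negP => Me.
set e := i2 - i1 in Me.
have t0 : 0 < t.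
  case: B bB sz {sB lo hi} => [|b B] bB; first by rewrite leqn0 addn_eq0; move: i12 l0 lk; clear; lia.
  by move=> _; have := bB b (mem_head _ _); clear; lia.
have main : block B i1 k * (t + e) ^ k <= block B i2 k * t ^ k.
  have cst x : x ^ k = \prod_(a < k) x by rewrite prod_nat_const card_ord.
  rewrite !cst /block -!big_split /=; apply: leq_prod => a _.
  have ak := ltn_ord a.
  have g := @nth_gap _ sB (i1 + a) (i2 + a) ltac:(move: i12 sz ak; clear; lia).
  have /andP[_ b] := @nth_bound _ _ bB (i1 + a) ltac:(move: i12 sz ak; clear; lia).
  have {}g : nth 0 B (i1 + a) + e <= nth 0 B (i2 + a).
    by move: g i12; rewrite /e; clear; lia.
  by move: g b; clear; nia.
have : t ^ l * (t + e) ^ k <= (t + M) ^ l * t ^ k.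
  apply: leq_trans (leq_trans main _); first by rewrite leq_mul2r lo orbT.
  by rewrite leq_mul2r hi orbT.
rewrite -(subnK lk) !expnD ![_ * (_ * _ ^ l)]mulnA ![_ ^ l * _ ^ (k - l)]mulnC.
move=> h.
have : (t + e) ^ (k - l) * (t ^ l * (t + e) ^ l) <= t ^ (k - l) * (t ^ l * (t + M) ^ l).
  by move: h; clear; nia.
have : t ^ (k - l) * (t ^ l * (t + M) ^ l) < (t + e) ^ (k - l) * (t ^ l * (t + e) ^ l).
  apply: (@leq_trans (t ^ (k - l) * (t ^ l * (t + e) ^ l))).
    by rewrite !ltn_mul2l !expn_gt0 t0 /= ltn_exp2r // ltn_add2l.
  rewrite leq_mul2r; apply/orP; right.
  by case: (k - l) => [|n] //; rewrite leq_exp2r // leq_addr.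
lia.
Qed.

(** Used with [t] the first element of J: nothing of J is known yet, so the whole product of I must
    decode. *)
Definition medium_ok t B (x : nat * nat) :=
  let S := fiber t (block B x.1 x.2) in
  [&& x.1 + x.2 <= size B, \prod_(n <- S) n == block B x.1 x.2,
      0 < size S < x.2 &
      short_max (scale (last t S)) <= (size S).-1 < long_min (scale (last t S))].

(** For a given length of the decoded tail and a given [k], [block_location] keeps the starts [i]
    within [M] of each other, so [i] modulo [M + 1] identifies them. *)
Lemma medium_count t B F : sorted ltn B -> (forall m, m \in B -> 2 <= m < t) ->
  uniq F -> all (medium_ok t B) F -> 2 ^ scale (2 * t) <= t ->
  size F <= (long_min (scale (2 * t))).+1 *
    (first_bound (scale (2 * t)) * (2 ^ scale (2 * t)).+1).
Proof.
move=> sB bB uF /allP okF Mt; set s := scale (2 * t) in Mt *; set M := 2 ^ s in Mt *.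
pose sz (x : nat * nat) := size (fiber t (block B x.1 x.2)).
pose fs : seq ((nat * nat -> nat) * nat) :=
  [:: (sz, (long_min s).+1); (snd, first_bound s); ((fun x => x.1 %% M.+1), M.+1)].
have <- : \prod_(fb <- fs) fb.2 = (long_min s).+1 * (first_bound s * M.+1).
  by rewrite !big_cons big_nil /= muln1.
have basic x : x \in F -> [/\ x.1 + x.2 <= size B, 0 < sz x < x.2,
    sz x <= long_min s, t ^ sz x <= block B x.1 x.2 & block B x.1 x.2 <= (t + M) ^ sz x].
  move=> /okF /and4P[h1 /eqP h2 h3 /andP[_ h4]].
  have yl : long_min (scale (last t (fiber t (block B x.1 x.2)))) <= long_min s.
    apply: long_min_mono; apply: scale_mono.
    by have := fiber_last t (block B x.1 x.2); rewrite -/s -/M; move: Mt; clear; lia.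
  split=> //; first by apply: leq_trans yl; apply: leq_trans h4; case/andP: h3; rewrite /sz; case: size.
    rewrite -h2 /sz; elim: (fiber _ _) (fiber_bound t (block B x.1 x.2)) => [|n S IH] hS.
      by rewrite big_nil.
    rewrite big_cons expnS leq_mul //.
      by have /andP[] := hS n (mem_head _ _).
    by apply: IH => m mS; apply: hS; rewrite inE mS orbT.
  rewrite -{1}h2 /sz; elim: (fiber _ _) (fiber_bound t (block B x.1 x.2)) => [|n S IH] hS.
    by rewrite big_nil.
  rewrite big_cons expnS leq_mul //.
    by have /andP[] := hS n (mem_head _ _).
  by apply: IH => m mS; apply: hS; rewrite inE mS orbT.
apply: size_le_prod => // [x xF|x x' xF x'F].
  have [h1 h2 h3 h4 h5] := basic x xF.
  rewrite /= ltnS h3 ltn_pmod // !andbT.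
  have : 2 ^ x.2 < 2 ^ (len_bound s * sz x).
    apply: (@leq_ltn_trans (block B x.1 x.2)).
      by apply: block_ge => a ax; have := @nth_bound _ _ bB a ltac:(move: ax h1; clear; lia); clear; lia.
    apply: leq_ltn_trans h5 _; rewrite expnM ltn_exp2r; last by case/andP: h2.
    apply: leq_ltn_trans (scale_lt (2 * t)).
    by move: Mt; rewrite -/s; clear; lia.
  rewrite ltn_exp2l // => /leq_trans; apply.
  by rewrite leq_mul2l; move: h3; clear; lia.
rewrite /= andbT => /and3P[/eqP s12 /eqP k12 /eqP i12].
have main y y' : y \in F -> y' \in F -> sz y = sz y' -> y.2 = y'.2 ->
    y.1 %% M.+1 = y'.1 %% M.+1 -> y.1 < y'.1 -> False.
  move=> yF y'F es ek ei lt_i.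
  have [h1 h2 h3 h4 h5] := basic y yF; have [g1 g2 g3 g4 g5] := basic y' y'F.
  have : y'.1 - y.1 <= M.
    apply: (block_location B t M y.1 y'.1 y.2 (sz y)) => //.
    - by rewrite ek.
    - by case/andP: h2 => -> /ltnW.
    - by rewrite ek es.
  have : M.+1 %| y'.1 - y.1 by rewrite -eqn_mod_dvd ?ei // ltnW.
  by move/dvdn_leq; rewrite subn_gt0 lt_i => /(_ isT); clear; lia.
case: x x' s12 k12 i12 xF x'F => [i k] [i' k'] /= s12 k12 i12 xF x'F.
case: (ltngtP i i') => ii; last by rewrite ii k12.
  by case: (main _ _ xF x'F s12 k12 i12 ii).
by case: (main _ _ x'F xF (esym s12) (esym k12) (esym i12) ii).
Qed.

(** * Expected costs of the threats *)

Lemma expS_bernoulli a n : (a ^ n.+1 + n.+1 * a ^ n <= a.+1 ^ n.+1)%N.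
Proof.
elim: n => [|n IHn]; first by rewrite !expn1 expn0 muln1 addn1.
rewrite [(a.+1 ^ n.+2)%N]expnS; apply: leq_trans (leq_mul (leqnn a.+1) IHn).
rewrite [(a ^ n.+2)%N]expnS [(a ^ n.+1)%N]expnS; move: (a ^ n)%N => x; nia.
Qed.

Section ThreatMeans.

Local Open Scope ring_scope.

Definition coin_rate (n : nat) : rat := (scale n)%:R^-1.

Lemma coin_rate01 n : 0 <= coin_rate n <= 1.
Proof.
rewrite /coin_rate invr_ge0 ler0n /=; case: (scale n) => [|s]; first by rewrite invr0.
by rewrite invf_le1 ?ltr0n // ler1n.
Qed.

Lemma pow_half_le (s : nat) : (0 < s)%N -> (1 - s%:R^-1) ^+ s <= (2^-1 : rat).
Proof.
case: s => // a _.
have aE : 1 - a.+1%:R^-1 = a%:R / a.+1%:R :> rat.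
  have : (a.+1%:R : rat) != 0 by rewrite pnatr_eq0.
  by rewrite -natr1 => h; field.
rewrite aE expr_div_n ler_pdivrMr ?exprn_gt0 ?ltr0n // mulrC ler_pdivlMr ?ltr0n //.
rewrite -!natrX -natrM ler_nat; apply: leq_trans (expS_bernoulli a a).
by rewrite mulnC mul2n -addnn leq_add2l expnS leq_mul2r leqnSn orbT.
Qed.

Lemma scaled_half_pow (a b q : nat) : (0 < b)%N -> (a * b <= 2 ^ q)%N ->
  a%:R * 2^-1 ^+ q <= b%:R^-1 :> rat.
Proof.
move=> b0 h; rewrite exprVn ler_pdivrMr ?exprn_gt0 ?ltr0n // mulrC.
by rewrite ler_pdivlMr ?ltr0n // -natrX -natrM ler_nat.
Qed.

Lemma prod_le_exp (I : eqType) (S : seq I) (f : I -> rat) (x : rat) :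
  (forall n, n \in S -> 0 <= f n <= x) -> \prod_(n <- S) f n <= x ^+ size S.
Proof.
elim: S => [|n S IHS] h; first by rewrite big_nil.
have /andP[f0 fx] := h n (mem_head _ _).
rewrite big_cons /= exprS ler_pM //.
  rewrite big_seq prodr_ge0 // => m mS.
  have mS' : m \in n :: S by rewrite inE mS orbT.
  by have /andP[] := h m mS'.
by apply: IHS => m mS; apply: h; rewrite inE mS orbT.
Qed.

(** With weights 1 and 0 the mean is the probability that all coins of the support accept; every [s]
    coins of scale at most [s] halve it. *)
Lemma prod_mean_presence (th : threat) s q : th.2 = (1, 0) -> (0 < s)%N ->
  (forall n, n \in tsupp th -> (0 < scale n <= s)%N) -> (s * q <= size (tsupp th))%N ->
  \prod_(n <- tsupp th) mean_wt coin_rate th n <= 2^-1 ^+ q.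
Proof.
move=> th2 s0 hs sq; set x : rat := 1 - s%:R^-1.
have x0 : 0 <= x by rewrite subr_ge0 invf_le1 ?ltr0n // ler1n.
have x1 : x <= 1 by rewrite lerBlDr lerDl invr_ge0 ler0n.
apply: (@le_trans _ _ (x ^+ size (tsupp th))).
  apply: prod_le_exp => n nS; have /andP[n0 ns] := hs n nS.
  have /andP[_ d1] := coin_rate01 n.
  rewrite /mean_wt /twt th2 /= mulr1 mulr0 addr0 subr_ge0 d1 lerD2l lerN2.
  by rewrite lef_pV2 ?posrE ?ltr0n // ler_nat.
apply: (@le_trans _ _ (x ^+ (s * q))); first exact: ler_wiXn2l.
rewrite exprM lerXn2r ?nnegrE ?exprn_ge0 ?invr_ge0 //.
exact: pow_half_le.
Qed.

Lemma sum_le_count (I : eqType) (s : seq I) (f : I -> rat) (u : rat) :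
  (forall x, x \in s -> f x <= u) -> \sum_(x <- s) f x <= (size s)%:R * u.
Proof.
elim: s => [|a s IHs] h; first by rewrite big_nil mul0r.
rewrite big_cons /= -natr1 mulrDl mul1r addrC lerD ?h ?mem_head //.
by apply: IHs => x xs; apply: h; rewrite inE xs orbT.
Qed.

Definition index_pairs (t : nat) := [seq (i, k) | i <- iota 0 t.+1, k <- iota 0 t.+1].
Definition index_triples (t : nat) := [seq (x, r) | x <- index_pairs t, r <- iota 0 t.+1].

(** A tail may begin before [t]: its known part, the last [x.2] elements of [B], is divided out
    before decoding. The cost [3 * y.+1] exceeds the whole budget at time [y], so such a threat can
    never be realized. *)
Definition long_threat (t : nat) (B : seq nat) (x : nat * nat * nat) : seq threat :=
  let S := fiber t (block B x.1.1 x.1.2 %/ block B (size B - x.2) x.2) in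
  let y := last t S in
  if (long_min (scale y) <= size (fiber_body S))%N
  then [:: (fiber_body S, y, (3 * y.+1)%:R, (1, 0))] else [::].

Definition long_threats t B := flatten [seq long_threat t B x | x <- index_triples t].

Definition medium_threat (t : nat) (B : seq nat) (x : nat * nat) : threat :=
  let S := fiber t (block B x.1 x.2) in (fiber_body S, last t S, 1, (1, 0)).

Definition medium_threats t B :=
  [seq medium_threat t B x | x <- index_pairs t & medium_ok t B x].

(* The weight 4 ^ (number of zeros) is an exponential moment: it exceeds its
   mean hugely as soon as a sixteenth of the window consists of zeros. *)
Definition zeros_threat (t M : nat) : threat :=
  (iota t M, t, (3 * (t + M).+1)%:R / 4 ^+ (M %/ 16), (1, 4)).

(** A window starting at [t] and ending at [y] has length [2 ^ scale y], and [scale y] is one of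
    these two scales. *)
Definition zeros_threats (t : nat) :=
  [:: zeros_threat t (2 ^ scale t); zeros_threat t (2 ^ scale (2 * t))].

Definition threats (n0 : nat) (h : seq bool) : seq threat :=
  let t := size h in let B := elts n0 (nth false h) t in
  if (t < n0)%N then [::] else long_threats t B ++ medium_threats t B ++ zeros_threats t.

Definition threat_mean (th : threat) : rat :=
  tcost th * \prod_(m <- tsupp th) mean_wt coin_rate th m.

Section Bounds.

Variables (t : nat) (B : seq nat).
Let s := scale t.
Hypothesis s_ge : (96 <= s)%N.
Hypothesis window_le : (2 ^ scale (2 * t) <= t)%N.

Lemma fiber_body_bound N n : n \in fiber_body (fiber t N) ->
  (t <= n)%N && (n <= last t (fiber t N))%N.
Proof using Type.
have := fiber_bound t N; have := fiber_sorted t N.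
case/lastP: (fiber t N) => [|S y] //; rewrite /fiber_body size_rcons /= -cats1 take_size_cat //.
rewrite cats1 last_rcons => sS hS nS.
have /andP[-> _] : (t <= n <= t + 2 ^ scale (2 * t))%N by apply: hS; rewrite mem_rcons inE nS orbT.
by move: sS; rewrite -cats1 (sorted_pairwise ltn_trans) pairwise_cat /= allrel1r => /andP[/allP/(_ n nS)/ltnW].
Qed.

Lemma fiber_body_scale N n : n \in fiber_body (fiber t N) ->
  (0 < scale n <= scale (last t (fiber t N)))%N.
Proof using s_ge.
move=> /fiber_body_bound/andP[tn ny]; rewrite (scale_mono _ _ ny) andbT.
by apply: leq_trans (scale_mono _ _ tn); apply: leq_trans s_ge.
Qed.

Lemma last_scale N : (s <= scale (last t (fiber t N)))%N.
Proof using Type. by apply: scale_mono; case/andP: (fiber_last t N). Qed.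

(** There are [(t + 1) ^ 3] candidates. A support of [8 * sy * len_bound sy] coins gives probability
    [2 ^ (- 8 * len_bound sy)], while the candidates, the cost and the factor [3 * s] together need
    only [2 ^ (6 * len_bound sy)]. *)
Lemma long_threats_mean :
  \sum_(th <- long_threats t B) threat_mean th <= (3 * s)%:R^-1.
Proof using s_ge window_le.
rewrite /long_threats big_flatten big_map /=.
have term x : \sum_(th <- long_threat t B x) threat_mean th <=
    (3 * s * (t.+1 ^ 3))%:R^-1.
  rewrite /long_threat; set N := (_ %/ _)%N; set y := last t _.
  case: ifP => [long_y|_]; last by rewrite big_nil invr_ge0 ler0n.
  rewrite big_seq1 /threat_mean /tcost /=.
  set sy := scale y in long_y.
  have sy_ge : (96 <= sy)%N by apply: leq_trans s_ge (last_scale N).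
  have := prod_mean_presence (fiber_body (fiber t N), y, (3 * y.+1)%:R, (1, 0)) sy (8 * len_bound sy) erefl.
  move=> /(_ (leq_trans _ sy_ge) _ _) h.
  apply: (@le_trans _ _ ((3 * y.+1)%:R * 2^-1 ^+ (8 * len_bound sy))).
    rewrite ler_wpM2l ?ler0n // h //.
      by move=> n; exact: fiber_body_scale.
    by rewrite /tsupp /= mulnA [(sy * 8)%N]mulnC.
  have t1 : (0 < 3 * s * t.+1 ^ 3)%N.
    by rewrite muln_gt0 expn_gt0 muln_gt0 (leq_trans _ s_ge).
  apply: scaled_half_pow => //.
  have yL : (y.+1 <= 2 ^ len_bound sy)%N by exact: scale_lt.
  have ty : (t <= y)%N by case/andP: (fiber_last t N).
  have sty : (s <= 2 ^ len_bound sy)%N.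
    apply: leq_trans yL; apply: leq_trans (ltnW (ltn_expl s (ltnSn 1))) _.
    apply: leq_trans (leq_trans _ (leq_trans ty (leqnSn y))).
      by apply: leqnn.
    apply: leq_trans (scale_leq_exp t _); last by apply: leq_trans s_ge.
    rewrite leq_exp2l // -/s -{1}[s]expn1 leq_pexp2l //.
    by apply: leq_trans s_ge.
  have nine : (9 <= 2 ^ len_bound sy)%N.
    apply: (@leq_trans (2 ^ 4)) => //; rewrite leq_exp2l // /len_bound.
    by apply: (@leq_trans (sy.+1 ^ 1)); [rewrite expn1; lia|rewrite leq_pexp2l].
  have tL : (t.+1 ^ 3 <= (2 ^ len_bound sy) ^ 3)%N.
    by rewrite leq_exp2r // (leq_trans _ yL).
  have := leq_mul nine (leq_mul yL (leq_mul sty tL)).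
  rewrite -expnM -!expnD => hh.
  apply: (@leq_trans (9 * (y.+1 * (s * t.+1 ^ 3)))).
    by rewrite mulnACA -!mulnA; lia.
  by apply: leq_trans hh _; rewrite leq_exp2l //; lia.
apply: (@le_trans _ _ ((size (index_triples t))%:R * (3 * s * (t.+1 ^ 3))%:R^-1)).
  by apply: sum_le_count => x _.
rewrite !size_allpairs !size_iota.
have t1 : (0 < t.+1 ^ 3)%N by rewrite expn_gt0.
have -> : (t.+1 * t.+1 * t.+1 = t.+1 ^ 3)%N by rewrite !expnS expn0 muln1 mulnA.
by rewrite [(3 * s * _)%:R]natrM invfM mulrCA mulfV ?mulr1 // pnatr_eq0 -lt0n.
Qed.

Hypothesis B_sorted : sorted ltn B.
Hypothesis B_bound : forall m, m \in B -> (2 <= m < t)%N.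
Hypothesis medium_small : (3 * s * ((long_min s.+1).+1 *
  (first_bound s.+1 * (2 ^ s.+1).+1)) <= 2 ^ (s ^ 2 - 1))%N.
Hypothesis zeros_small : (6 + s + len_bound s <= 2 ^ (s - 4))%N.

Lemma medium_threats_mean :
  \sum_(th <- medium_threats t B) threat_mean th <= (3 * s)%:R^-1.
Proof using All.
have term x : x \in [seq x <- index_pairs t | medium_ok t B x] ->
    threat_mean (medium_threat t B x) <= 2^-1 ^+ (s ^ 2 - 1).
  rewrite mem_filter => /andP[/and4P[_ _ _ /andP[short_le _]] _].
  set S := fiber t _ in short_le; set sy := scale _ in short_le.
  have ssy : (s <= sy)%N by exact: last_scale.
  rewrite /threat_mean /tcost /= mul1r.
  apply: (@prod_mean_presence _ sy) => //.
  - by apply: leq_trans ssy; apply: leq_trans s_ge.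
  - by move=> n; exact: fiber_body_scale.
  apply: (@leq_trans (short_max sy)); last first.
    by rewrite /tsupp /= /fiber_body size_takel ?leq_pred.
  (* [short_max] factors as [sy * (sy ^ 2 - 1)], that is, [sy ^ 2 - 1] halvings. *)
  rewrite /short_max [(sy ^ 3)%N]expnS.
  have -> : (sy * sy ^ 2 - sy = sy * (sy ^ 2 - 1))%N.
    by rewrite mulnBr muln1.
  rewrite leq_mul2l leq_sub2r ?orbT //.
  by rewrite leq_exp2r.
rewrite /medium_threats big_map; apply: le_trans (sum_le_count _ _ _ _ term) _.
have s_gt0 : (0 < s)%N by apply: leq_trans s_ge.
apply: scaled_half_pow; first by rewrite muln_gt0.
apply: leq_trans medium_small; rewrite mulnC leq_mul2l; apply/orP; right.
have sig : (scale (2 * t) <= s.+1)%N by exact: scale_double.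
apply: (@leq_trans ((long_min (scale (2 * t))).+1 *
    (first_bound (scale (2 * t)) * (2 ^ scale (2 * t)).+1))); last first.
  have h1 := long_min_mono _ _ sig; have h2 := first_bound_mono _ _ sig.
  have h3 : (2 ^ scale (2 * t) <= 2 ^ s.+1)%N by rewrite leq_exp2l.
  exact: leq_mul (_ : _.+1 <= _.+1)%N (leq_mul h2 (_ : _.+1 <= _.+1)%N).
apply: (medium_count t B) => //; last exact: filter_all.
rewrite filter_uniq // /index_pairs allpairs_uniq ?iota_uniq //.
by move=> [i k] [i' k'] _ _ /=.
Qed.

(** A coin has mean weight at most [1 + 3 / s <= 33 / 32], so 16 of them contribute at most 2,
    whereas the cost divides by 4 for every 16. *)
Lemma zeros_threat_mean (s' : nat) : (s <= s')%N -> (2 ^ s' <= t)%N ->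
  threat_mean (zeros_threat t (2 ^ s')) <= (6 * s)%:R^-1.
Proof using s_ge zeros_small.
move=> ss' Mt; rewrite /threat_mean /tcost /=.
set M := (2 ^ s')%N in Mt *; pose H := (2 ^ (s' - 4))%N.
have ME : M = (16 * H)%N.
  by rewrite /M /H -(expnD 2 4) subnKC //; move: s_ge ss'; clear; lia.
rewrite {2}ME mulKn //.
have s_gt0 : (0 < s)%N by apply: leq_trans s_ge.
have s0 : 0 < s%:R :> rat by rewrite ltr0n.
have prodM : \prod_(m <- iota t M) mean_wt coin_rate (zeros_threat t M) m <= 2 ^+ H.
  apply: (@le_trans _ _ ((1 + 3 / s%:R) ^+ size (iota t M))).
    apply: prod_le_exp => m; rewrite mem_iota => /andP[tm _].
    have := coin_rate01 m; have : coin_rate m <= s%:R^-1.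
      have sm : (s <= scale m)%N by exact: scale_mono.
      by rewrite lef_pV2 ?posrE ?ltr0n ?ler_nat //; apply: leq_trans sm.
    by rewrite /mean_wt /twt /=; move: (coin_rate m) (s%:R^-1) => d u; lra.
  rewrite size_iota ME exprM lerXn2r ?nnegrE ?exprn_ge0 ?addr_ge0 ?divr_ge0 ?ltW //.
  have x0 : 0 <= 3 / s%:R :> rat by rewrite divr_ge0 ?ltW.
  have x1 : 3 / s%:R <= 32^-1 :> rat.
    rewrite (ler_pdivrMr _ _ s0).
    have s96 : (96 : rat) <= s%:R by rewrite ler_nat.
    by lra.
  move: (3 / s%:R) x0 x1 => x x0 x1.
  (* Four squarings, through the bounds 16/15, 8/7, 4/3 and 2. *)
  rewrite (_ : 16 = 2 * 2 * 2 * 2)%N // !exprM.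
  have h1 : (1 + x) ^+ 2 <= 16 / 15 by rewrite expr2; nra.
  have h1' : 0 <= (1 + x) ^+ 2 by rewrite exprn_ge0 // addr_ge0.
  move: ((1 + x) ^+ 2) h1 h1' => u1 h1 h1'.
  have h2 : u1 ^+ 2 <= 8 / 7 by rewrite expr2; nra.
  have h2' : 0 <= u1 ^+ 2 by rewrite exprn_ge0.
  move: (u1 ^+ 2) h2 h2' => u2 h2 h2'.
  have h3 : u2 ^+ 2 <= 4 / 3 by rewrite expr2; nra.
  have h3' : 0 <= u2 ^+ 2 by rewrite exprn_ge0.
  move: (u2 ^+ 2) h3 h3' => u3 h3 h3'.
  by rewrite expr2; nra.
apply: (@le_trans _ _ ((3 * (t + M).+1)%:R * 2^-1 ^+ H)).
  apply: (@le_trans _ _ ((3 * (t + M).+1)%:R / 4 ^+ H * 2 ^+ H)).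
    by rewrite ler_wpM2l ?divr_ge0 ?exprn_ge0 ?ler0n.
  rewrite -mulrA ler_wpM2l ?ler0n // (_ : 4 = 2 * 2 :> rat); last by rewrite -natrM.
  by rewrite exprMn invfM -mulrA mulVf ?mulr1 ?exprVn // expf_neq0.
apply: scaled_half_pow; first by rewrite muln_gt0.
have tL : (t.+1 <= 2 ^ len_bound s)%N by exact: scale_lt.
have sE : (s <= 2 ^ s)%N by rewrite ltnW // ltn_expl.
have HE : (6 + s + len_bound s <= H)%N.
  by apply: leq_trans zeros_small _; rewrite leq_exp2l // leq_sub2r.
apply: (@leq_trans (2 ^ 6 * 2 ^ s * 2 ^ len_bound s)).
  apply: (@leq_trans (64 * s * t.+1)); first by move: Mt; clear; nia.
  by rewrite leq_mul // leq_mul.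
by rewrite -!expnD leq_exp2l.
Qed.

Lemma zeros_threats_mean :
  \sum_(th <- zeros_threats t) threat_mean th <= (3 * s)%:R^-1.
Proof using s_ge zeros_small window_le.
rewrite /zeros_threats !big_cons big_nil addr0.
have s2 : (s <= scale (2 * t))%N by rewrite scale_mono // leq_pmull.
have w1 : (2 ^ scale t <= t)%N by apply: leq_trans window_le; rewrite leq_exp2l.
have := zeros_threat_mean _ s2 window_le; have := zeros_threat_mean _ (leqnn s) w1.
have -> : (3 * s)%:R^-1 = (6 * s)%:R^-1 + (6 * s)%:R^-1 :> rat.
  have : (s%:R : rat) != 0 by rewrite pnatr_eq0 -lt0n; apply: leq_trans s_ge.
  by rewrite !natrM => h; field.
by move=> h1 h2; exact: lerD.
Qed.

End Bounds.

(** Long, medium and zeros threats each receive a third of the budget [1 / scale]. *)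
Lemma threats_mean (n0 s0 : nat) (h : seq bool) :
  (2 <= n0)%N -> (96 <= s0)%N -> (2 ^ (s0 ^ 4) <= n0)%N ->
  (forall s, s0 <= s -> 3 * s * ((long_min s.+1).+1 *
    (first_bound s.+1 * (2 ^ s.+1).+1)) <= 2 ^ (s ^ 2 - 1))%N ->
  (forall s, s0 <= s -> 6 + s + len_bound s <= 2 ^ (s - 4))%N ->
  \sum_(th <- threats n0 h) threat_mean th <= (scale (size h))%:R^-1.
Proof.
move=> n0_ge2 s0_ge n0_ge hm hz; rewrite /threats.
case: ltnP => [_|n0t]; first by rewrite big_nil invr_ge0 ler0n.
set t := size h in n0t *; set B := elts _ _ _.
have s0s : (s0 <= scale t)%N by apply: scale_ge; exact: leq_trans n0t.
have s_ge : (96 <= scale t)%N by exact: leq_trans s0s.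
have wl : (2 ^ scale (2 * t) <= t)%N.
  have s_gt0 : (0 < scale t)%N by apply: leq_trans s_ge.
  apply: leq_trans (scale_leq_exp _ s_gt0); rewrite leq_exp2l //.
  apply: leq_trans (scale_double t) _.
  by have := exp4_ge (scale t); move: s_ge; clear; lia.
have Bs := elts_sorted n0 (nth false h) t.
have Bb m : m \in B -> (2 <= m < t)%N by exact: elts_bound.
rewrite big_cat big_cat.
have h1 := long_threats_mean t B s_ge wl.
have h2 := medium_threats_mean t B s_ge wl Bs Bb (hm _ s0s) (hz _ s0s).
have h3 := zeros_threats_mean t s_ge wl (hz _ s0s).
apply: le_trans (lerD h1 (lerD h2 h3)) _.
have : ((scale t)%:R : rat) != 0 by rewrite pnatr_eq0 -lt0n; apply: leq_trans s_ge.
rewrite le_eqVlt => hn; apply/orP; left; apply/eqP.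
by rewrite natrM; field.
Qed.

Lemma fiber_body_uniq t N : uniq (fiber_body (fiber t N)).
Proof. by rewrite take_uniq // filter_uniq // iota_uniq. Qed.

Lemma fiber_body_ge t N : all (leq t) (fiber_body (fiber t N)).
Proof. by apply/allP => n /mem_take/fiber_bound/andP[]. Qed.

Lemma threats_ok n0 h : all (threat_ok (size h)) (threats n0 h).
Proof.
rewrite /threats; case: ifP => // _; set t := size h; set B := elts _ _ _.
rewrite all_cat all_cat; apply/and3P; split; apply/allP => th.
- case/flattenP=> l /mapP[x _ ->]; rewrite /long_threat; case: ifP => // _.
  rewrite inE => /eqP ->; rewrite /threat_ok /tsupp /tcost /twt /=.
  by rewrite fiber_body_uniq fiber_body_ge ler0n.
- case/mapP=> x _ ->; rewrite /threat_ok /tsupp /tcost /twt /=.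
  by rewrite fiber_body_uniq fiber_body_ge.
have ok M : threat_ok t (zeros_threat t M).
  have ge_t : all (leq t) (iota t M) by apply/allP => n; rewrite mem_iota => /andP[].
  by rewrite /threat_ok /tsupp /tcost /twt /= iota_uniq ge_t divr_ge0 ?ler0n ?exprn_ge0.
by rewrite !inE => /orP[] /eqP ->.
Qed.

End ThreatMeans.

(** * Clashes of the realized sequence *)

Lemma block_cat B1 S w : w <= size B1 ->
  block (B1 ++ S) w (size (B1 ++ S) - w) =
  block B1 w (size B1 - w) * \prod_(n <- S) n.
Proof.
move=> wB; rewrite size_cat (_ : _ + _ - w = size B1 - w + size S); last by lia.
rewrite /block big_split_ord /=; congr (_ * _).
  by apply: eq_bigr => a _; rewrite nth_cat; have := ltn_ord a; case: ifP => //; lia.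
rewrite (big_nth 0) big_mkord; apply: eq_bigr => a _.
by rewrite nth_cat addnA subnKC // ltnNge leq_addr /= addKn.
Qed.

Lemma block_cat_left B1 S i k : i + k <= size B1 ->
  block (B1 ++ S) i k = block B1 i k.
Proof.
move=> h; apply: eq_bigr => a _; rewrite nth_cat (leq_trans _ h) //.
by rewrite ltn_add2l.
Qed.

Lemma prod_if_count (P : pred nat) (x : rat) (s : seq nat) :
  (\prod_(m <- s) (if P m then x else 1) = x ^+ count P s)%R.
Proof.
elim: s => [|m s IHs]; first by rewrite big_nil.
by rewrite big_cons IHs /=; case: (P m); rewrite ?exprS ?mul1r.
Qed.

Section Realization.

Variables (n0 s0 : nat) (c : nat -> bool).
Hypothesis n0_ge2 : 2 <= n0.
Hypothesis s0_ge : 96 <= s0.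
Hypothesis n0_ge : 2 ^ (s0 ^ 4) <= n0.
Hypothesis s0_count : forall s, s0 <= s ->
  48 * (long_min s + long_min s * (first_bound s * (first_bound s *
    (8 * (long_min s))))) + 208 <= 2 ^ s.

Local Notation B := (elts n0 c).
Local Notation adm := (admitted n0 c).

Definition realized_cost (n t : nat) : rat := (\sum_(th <- threats n0 (mkseq c t))
  tcost th * weight coin_rate c n th)%R.

Hypothesis c_cost : forall n,
  (\sum_(m < n) (~~ c m)%:R + \sum_(t < n.+1) realized_cost n t <=
   \sum_(m < n) coin_rate m + \sum_(t < n.+1) coin_rate t)%R.

Lemma threat_cost_ge0 n t th : th \in threats n0 (mkseq c t) ->
  (0 <= tcost th * weight coin_rate c n th)%R.
Proof using Type.
move=> thT; have ok := allP (threats_ok n0 (mkseq c t)) th thT.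
rewrite mulr_ge0 ?(weight_ge0 _ coin_rate01 _ _ _ _ ok) //.
by case/and5P: ok.
Qed.

Lemma cost_ge0 n t : (0 <= realized_cost n t)%R.
Proof using Type. by rewrite /realized_cost big_seq sumr_ge0 // => th; exact: threat_cost_ge0. Qed.

(** All terms on the left of the budget are nonnegative and the right side consists of [2 * n + 1]
    rates. A threat costing more cannot be realized. *)
Lemma threat_cost_le n t th : t <= n -> th \in threats n0 (mkseq c t) ->
  (tcost th * weight coin_rate c n th <= (2 * n).+1%:R)%R.
Proof using c_cost.
move=> tn thT.
have one : (tcost th * weight coin_rate c n th <= realized_cost n t)%R.
  rewrite /realized_cost (big_rem th thT) /= lerDl big_seq sumr_ge0 // => th' /mem_rem.
  exact: threat_cost_ge0.
have two : (realized_cost n t <= \sum_(m < n) (~~ c m)%:R + \sum_(t < n.+1) realized_cost n t)%R.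
  have tn1 : t < n.+1 by [].
  rewrite (bigD1 (Ordinal tn1)) //= addrCA lerDl addr_ge0 ?sumr_ge0 // => i _.
  exact: cost_ge0.
apply: le_trans one (le_trans two (le_trans (c_cost n) _)).
have rate_sum m : (\sum_(i < m) coin_rate i <= m%:R)%R.
  elim: m => [|m IHm]; first by rewrite big_ord0.
  rewrite big_ord_recr -natr1 lerD //.
  by have /andP[] := coin_rate01 m.
by apply: le_trans (lerD (rate_sum n) (rate_sum n.+1)) _; rewrite -natrD ler_nat; clear; lia.
Qed.

Lemma threatsE t : n0 <= t -> threats n0 (mkseq c t) =
  long_threats t (B t) ++ medium_threats t (B t) ++ zeros_threats t.
Proof using Type.
move=> n0t; rewrite /threats size_mkseq ltnNge n0t /=.
have -> : elts n0 (nth false (mkseq c t)) t = B t.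
  by apply: elts_ext => m mt; rewrite nth_mkseq.
by [].
Qed.

Lemma weight_presence n th : th.2 = (1, 0)%R ->
  (forall m, m \in tsupp th -> (m < n) && c m) -> weight coin_rate c n th = 1%R.
Proof using Type.
move=> th2 h; rewrite /weight big_seq big1 // => m ms.
by have /andP[-> cm] := h m ms; rewrite /twt th2 cm.
Qed.

(** With too many zeros the realized weight is at least [4 ^ (M / 16)], so the zeros threat would
    cost at least [3 * y.+1]. *)
Lemma zeros_few y : n0 + 2 ^ scale y <= y ->
  16 * count (fun n => ~~ c n) (iota (y - 2 ^ scale y) (2 ^ scale y)) <= 2 ^ scale y.
Proof using n0_ge2 s0_ge n0_ge c_cost.
set M := 2 ^ scale y => yM; set t := y - M; rewrite leqNgt; apply/negP => many.
have s0y : 96 <= scale y.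
  apply: leq_trans s0_ge _; apply: scale_ge; apply: leq_trans n0_ge _.
  by move: yM; clear; lia.
have M16 : M = 16 * (M %/ 16).
  by rewrite /M -(subnK (_ : 4 <= scale y)) ?expnD 1?mulKn // ?(leq_trans _ s0y) // mulnC mulKn.
have M2 : 2 * M <= y.
  apply: leq_trans (scale_leq_exp y (leq_trans _ s0y)) => //; rewrite /M -expnS leq_exp2l //.
  by have := exp4_ge (scale y); move: s0y; clear; lia.
have ty : t + M = y by rewrite subnK //; move: yM; clear; lia.
have n0t : n0 <= t by move: yM ty; clear; lia.
have th_in : zeros_threat t M \in threats n0 (mkseq c t).
  rewrite threatsE // !mem_cat; apply/orP; right; apply/orP; right.
  have sy2 : scale y <= scale (2 * t) by apply: scale_mono; move: M2 ty; clear; lia.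
  have sty : scale t <= scale y by apply: scale_mono; move: ty; clear; lia.
  have := scale_double t; rewrite /M !inE => s2.
  have [->|->] : scale y = scale t \/ scale y = scale (2 * t) by move: sy2 sty s2; clear; lia.
    by rewrite eqxx.
  by rewrite eqxx orbT.
have := threat_cost_le y t _ (leq_subr _ _) th_in; rewrite leNgt => /negP; apply.
rewrite /tcost /weight /= ty.
have -> : (\prod_(m <- iota t M) (if (m < y)%N then twt (zeros_threat t M) (c m)
    else mean_wt coin_rate (zeros_threat t M) m) =
    4 ^+ count (fun n => ~~ c n) (iota t M))%R.
  rewrite big_seq (eq_bigr (fun m => (if ~~ c m then 4 else 1 : rat)))%R; last first.
    by move=> m; rewrite mem_iota ty => /andP[_ ->]; rewrite /twt /=; case: (c m).
  by rewrite -big_seq prod_if_count.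
set k := count _ _ in many *.
have kM : M %/ 16 <= k by move: many M16; clear; lia.
apply: (@lt_le_trans _ _ ((3 * y.+1)%:R)%R); first by rewrite ltr_nat; clear; lia.
rewrite -mulrA ler_peMr ?ler0n // mulrC ler_pdivlMr ?exprn_gt0 // mul1r.
exact: ler_weXn2l.
Qed.

Lemma fiber_window t y : n0 <= t -> t <= y <= t + 2 ^ scale (2 * t) -> rough y ->
  fiber t ((\prod_(n <- seq.filter adm (iota t (y - t))) n) * y) =
  rcons (seq.filter adm (iota t (y - t))) y.
Proof using n0_ge2.
move=> n0t /andP[ty yt] ry; set S := seq.filter _ _.
have -> : (\prod_(n <- S) n) * y = \prod_(n <- rcons S y) n.
  by rewrite -cats1 big_cat /= big_seq1.
have memS n : n \in S -> t <= n < y /\ adm n.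
  by rewrite mem_filter mem_iota subnKC // => /andP[].
apply: fiber_prod; first by move: n0t n0_ge2; clear; lia.
  have : sorted ltn (seq.filter (fun n => adm n || (n == y)) (iota t (y - t).+1)).
    by rewrite sorted_filter ?iota_ltn_sorted //; exact: ltn_trans.
  rewrite -addn1 iotaD filter_cat subnKC //= eqxx orbT cats1.
  rewrite (eq_in_filter (a2 := adm)) // => n; rewrite mem_iota subnKC // => /andP[_ ny].
  by rewrite (ltn_eqF ny) orbF.
move=> n; rewrite mem_rcons inE => /orP[/eqP ->|/memS[/andP[tn ny] /and4P[_ _ rn _]]].
  by rewrite ty yt.
by rewrite tn rn andbT; move: ny yt; clear; lia.
Qed.

Lemma body_rcons S (y : nat) : fiber_body (rcons S y) = S.
Proof using Type. by rewrite /fiber_body size_rcons /= -cats1 take_size_cat. Qed.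

Lemma window_le y : n0 <= y -> 2 * 2 ^ scale y <= y.
Proof using s0_ge n0_ge.
move=> n0y; have s0y : 96 <= scale y.
  by apply: leq_trans s0_ge _; apply: scale_ge; apply: leq_trans n0_ge _.
apply: leq_trans (scale_leq_exp y (leq_trans _ s0y)) => //; rewrite -expnS leq_exp2l //.
by have := exp4_ge (scale y); move: s0y; clear; lia.
Qed.

Lemma tail_start y t : n0 <= t <= y -> y <= t + 2 ^ scale y ->
  t <= y <= t + 2 ^ scale (2 * t).
Proof using s0_ge n0_ge.
move=> /andP[n0t ty] yt; rewrite ty (leq_trans yt) // leq_add2l leq_exp2l // scale_mono //.
by have := window_le y (leq_trans n0t ty); move: yt; clear; lia.
Qed.

Lemma nth_elts_start y w : w < size (B y) ->
  let t := nth 0 (B y) w in [/\ n0 <= t, t < y & size (B t) = w].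
Proof using n0_ge2.
move=> wB t; have tB : t \in B y by rewrite mem_nth.
have := tB; rewrite elts_memE => /andP[ty /and4P[n0t _ _ _]]; split=> //.
have cat := elts_cat n0 c _ _ (ltnW ty).
have sB := elts_sorted n0 c y.
apply/eqP; rewrite eqn_leq; apply/andP; split; rewrite leqNgt; apply/negP => lt_w.
  have : t \in B t.
    have tE : nth 0 (B y) w = nth 0 (B t) w by rewrite cat nth_cat lt_w.
    by rewrite -[X in X \in _]/(nth 0 (B y) w) tE mem_nth.
  by rewrite elts_memE ltnn.
have szlt : size (B t) < size (B y) by exact: ltn_trans wB.
have := @nth_gap _ sB (size (B t)) w; rewrite -/t (ltnW lt_w) wB => /(_ isT).
have : t <= nth 0 (B y) (size (B t)).
  have : nth 0 (B y) (size (B t)) \in seq.filter adm (iota t (y - t)).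
    rewrite cat nth_cat ltnn subnn mem_nth // -(ltn_add2l (size (B t))) addn0.
    by rewrite -size_cat -cat.
  by rewrite mem_filter mem_iota => /and3P[].
by move: lt_w; clear; lia.
Qed.

(* The part of the tail below t is known at time t, so the history determines the
   product of the part in [t, y]. *)
Lemma clash_split y t i k r : t <= y -> clash (B y) y i k r ->
  size (B y) - r <= size (B t) ->
  let r' := size (B t) - (size (B y) - r) in
  block (B t) i k = block (B t) (size (B t) - r') r' *
    ((\prod_(n <- seq.filter adm (iota t (y - t))) n) * y).
Proof using n0_ge2.
move=> ty /and3P[k0 sz /eqP E] wt r'; have cat := elts_cat n0 c _ _ ty.
set w := size (B y) - r in wt E r' *.
have -> : size (B t) - r' = w by rewrite /r' subKn.
have rE : r = size (B y) - w by rewrite /w subKn //; move: sz; clear; lia.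
rewrite mulnA -block_cat // -cat -rE -E {1}cat block_cat_left //.
by apply: leq_trans wt; rewrite /w; move: sz; clear; lia.
Qed.

(** A long clash realizes a long threat announced at a suitable [t], whose cost is over budget. *)
Lemma not_long y : n0 <= y -> rough y -> populated n0 c y -> ~ long n0 c y.
Proof using n0_ge2 s0_ge n0_ge c_cost.
move=> n0y ry dy [i [k [r [cl long_r]]]].
have s0y : 0 < scale y.
  apply: leq_trans (scale_ge s0 y (leq_trans n0_ge n0y)).
  by apply: leq_trans s0_ge.
have r0 : 0 < r by apply: leq_trans long_r; exact: long_min_gt0.
have /and3P[k0 sz _] := cl.
have wB : size (B y) - r < size (B y) by move: sz r0; clear; lia.
have [n0a ay szBa] := nth_elts_start y _ wB.
set a := nth 0 (B y) (size (B y) - r) in n0a ay szBa.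
(* Take the start of J if it is within [2 ^ scale y] of [y]; otherwise cut J to the window before
   [y], which is populated. *)
have [t [n0t ty yt wt longS]] : exists t, [/\ n0 <= t, t <= y,
    y <= t + 2 ^ scale y, size (B y) - r <= size (B t) &
    long_min (scale y) <= size (seq.filter adm (iota t (y - t)))].
  have [near|far] := leqP y (a + 2 ^ scale y).
    exists a; split=> //; [exact: ltnW | by rewrite szBa |].
    have := congr1 size (elts_cat n0 c _ _ (ltnW ay)).
    by rewrite size_cat szBa; move: long_r sz; clear; lia.
  have ya : a <= y - 2 ^ scale y by move: far; clear; lia.
  have yy : y - 2 ^ scale y <= y by exact: leq_subr.
  exists (y - 2 ^ scale y); split=> //.
  - exact: leq_trans ya.
  - by move: (2 ^ scale y); clear; lia.
  - rewrite -szBa (elts_cat n0 c _ _ ya) size_cat; exact: leq_addr.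
  rewrite size_filter subKn; last by move: far; clear; lia.
  by apply: dy; move: far n0a; clear; lia.
have tyw := tail_start y t ltac:(by rewrite n0t) yt.
have fw := fiber_window t y n0t tyw ry.
have E := clash_split y t i k r ty cl wt.
set S := seq.filter _ _ in longS fw E; set r' := size (B t) - _ in E.
have pos : 0 < block (B t) (size (B t) - r') r'.
  apply: (block_gt0 _ t (elts_sorted _ _ _)); last by rewrite subnK // leq_subr.
  by move=> m; exact: elts_bound.
have N_eq : fiber t (block (B t) i k %/ block (B t) (size (B t) - r') r') = rcons S y.
  by rewrite E mulKn.
pose th : threat := (S, y, (3 * y.+1)%:R%R, (1, 0)%R).
have th_in : th \in threats n0 (mkseq c t).
  rewrite threatsE // mem_cat; apply/orP; left; apply/flattenP.
  exists (long_threat t (B t) (i, k, r')); last first.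
    by rewrite /long_threat N_eq last_rcons body_rcons longS mem_head.
  apply: map_f; have szt : size (B t) <= t.
    by rewrite elts_filter size_filter (leq_trans (count_size _ _)) // size_iota.
  apply: allpairs_f; first apply: allpairs_f; rewrite mem_iota /= add0n ltnS;
    apply: leq_trans szt; rewrite ?leq_subr //; move: sz wt; clear; lia.
have := threat_cost_le y t th ty th_in.
rewrite weight_presence // ?mulr1 /tcost /=.
  by rewrite ler_nat; clear; lia.
move=> m; rewrite mem_filter mem_iota subnKC // => /and3P[/and4P[_ -> _ _] _ ->].
by [].
Qed.

(** Strong induction: populated windows below [y] exclude long clashes there, and this populates the
    window of [y]. *)
Lemma always_populated y : n0 <= y -> populated n0 c y.
Proof using All.
elim/ltn_ind: y => y IHy n0y; move=> hy.
have s04 : 4 <= s0 by exact: leq_trans s0_ge.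
have IH y1 : n0 <= y1 < y -> populated n0 c y1 by case/andP=> h1 h2; exact: IHy.
apply: (populated_step n0 c n0_ge2 s0 s04 n0_ge s0_count) => //; first exact: zeros_few.
by move=> y1 /[dup] /IH d1 /andP[n01 _] r1; exact: not_long.
Qed.

Definition medium y :=
  [&& rough y, forced (B y) y & short_max (scale y) <= (witness (B y) y).2].

(** The threat is announced at the first element [t] of J. All coins of J before [y] accepted, so
    its weight is 1. *)
Lemma medium_realized y n : n0 <= y -> medium y -> y <= n ->
  exists t th, [/\ t <= y, th \in threats n0 (mkseq c t), ttag th = y &
    (1 <= tcost th * weight coin_rate c n th)%R].
Proof using All.
move=> n0y /and3P[ry /witnessP cl short_r] yn.
move: (witness (B y) y) cl short_r => [[i k] r] /= cl short_r.
have dy := always_populated y n0y.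
have long_r : r < long_min (scale y).
  by rewrite ltnNge; apply/negP => h; apply: (not_long y n0y ry dy); exists i, k, r.
have s0y : 2 <= scale y.
  apply: leq_trans (scale_ge s0 y (leq_trans n0_ge n0y)).
  by apply: leq_trans s0_ge.
have r0 : 0 < r.
  apply: leq_trans short_r; rewrite /short_max subn_gt0 -{1}[scale y]expn1.
  by rewrite ltn_exp2l.
have /and3P[k0 sz _] := cl.
have wB : size (B y) - r < size (B y) by move: sz r0; clear; lia.
have [n0t ty szBt] := nth_elts_start y _ wB.
set t := nth 0 (B y) (size (B y) - r) in n0t ty szBt.
(* Otherwise J would contain a whole populated window, and so at least [long_min] elements before
   [y]. *)
have yt : y <= t + 2 ^ scale y.
  rewrite leqNgt; apply/negP => far.
  have tz : t <= y - 2 ^ scale y by move: far; clear; lia.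
  have /dy : n0 + 2 ^ scale y <= y by move: far n0t; clear; lia.
  have := congr1 size (elts_cat n0 c _ _ (leq_subr (2 ^ scale y) y)).
  rewrite size_cat [size (seq.filter _ _)]size_filter subKn; last by move: far; clear; lia.
  have := congr1 size (elts_cat n0 c _ _ tz); rewrite size_cat szBt.
  by move: long_r sz; clear; lia.
have tyw : t <= y <= t + 2 ^ scale (2 * t).
  by apply: tail_start yt; rewrite n0t ltnW.
have fw := fiber_window t y n0t tyw ry.
have := clash_split y t i k r (ltnW ty) cl; rewrite szBt leqnn => /(_ isT) /=.
rewrite subnn subn0 [block _ _ 0]/block big_ord0 mul1n => E.
have szS : size (seq.filter adm (iota t (y - t))) = r.
  have := congr1 size (elts_cat n0 c _ _ (ltnW ty)); rewrite size_cat szBt.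
  by move: sz; clear; lia.
set S := seq.filter _ _ in fw E szS.
have N_eq : fiber t (block (B t) i k) = rcons S y by rewrite E.
exists t, (S, y, 1%R, (1, 0)%R); split; [exact: ltnW| |by []|]; last first.
  rewrite weight_presence // ?mulr1 /tcost //= => m.
  rewrite mem_filter mem_iota subnKC ?(ltnW ty) // => /and3P[/and4P[_ -> _ _] _ my].
  by rewrite (leq_trans my).
rewrite threatsE // !mem_cat; apply/orP; right; apply/orP; left.
have -> : (S, y, 1%R, (1, 0)%R) = medium_threat t (B t) (i, k).
  by rewrite /medium_threat N_eq last_rcons body_rcons.
apply: map_f; rewrite mem_filter; apply/andP; split.
  rewrite /medium_ok /= N_eq size_rcons last_rcons szS short_r long_r andbT /=.
  have rk : r.+1 < k by exact: (clash_rest_lt _ y (elts_sorted _ _ _) (@elts_bound _ _ n0_ge2 y) _ _ _ cl).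
  rewrite rk andbT -cats1 big_cat big_seq1 /= -E eqxx andbT szBt.
  by move: sz; clear; lia.
have szt : size (B t) <= t.
  by rewrite elts_filter size_filter (leq_trans (count_size _ _)) // size_iota.
by apply: allpairs_f; rewrite mem_iota /= add0n ltnS; apply: leq_trans szt;
  move: sz szBt; clear; lia.
Qed.

Lemma count_le_sum (s : seq threat) (f : threat -> rat) :
  (forall th, th \in s -> 0 <= f th)%R ->
  ((count (fun th => 1 <= f th)%R s)%:R <= \sum_(th <- s) f th)%R.
Proof using Type.
elim: s => [|a s IHs] h; first by rewrite big_nil.
rewrite big_cons /= natrD lerD //; last first.
  by apply: IHs => th ths; apply: h; rewrite inE ths orbT.
by case E : (1 <= f a)%R => //; apply: h; rewrite mem_head.
Qed.

(** Distinct medium refusals realize threats with distinct tags, each of cost at least 1, so the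
    budget also bounds their number. *)
Lemma zeros_medium_count n :
  ((count (fun m => ~~ c m) (iota 0 n) +
    count (fun y => (n0 <= y)%N && medium y) (iota 0 n))%:R <=
   \sum_(m < n) coin_rate m + \sum_(t < n.+1) coin_rate t)%R.
Proof using All.
apply: le_trans (c_cost n); rewrite natrD lerD //.
  rewrite -sum1_count natr_sum -(big_mkord xpredT (fun m => (~~ c m)%:R : rat)%R).
  rewrite /index_iota subn0 big_mkcond /= le_eqVlt; apply/orP; left; apply/eqP.
  by apply: eq_bigr => m _; case: (c m).
pose good (th : threat) : bool := (1 <= tcost th * weight coin_rate c n th)%R.
pose G := flatten [seq seq.filter good (threats n0 (mkseq c t)) | t <- iota 0 n.+1].
apply: (@le_trans _ _ ((size G)%:R)%R).
  rewrite ler_nat -size_filter -(size_map ttag G).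
  apply: uniq_leq_size; first by rewrite filter_uniq // iota_uniq.
  move=> y; rewrite mem_filter mem_iota /= add0n => /andP[/andP[n0y my] yn].
  have [t [th [ty th_in <- one]]] := medium_realized y n n0y my (ltnW yn).
  apply: map_f; apply/flattenP; exists (seq.filter good (threats n0 (mkseq c t))).
    by apply/mapP; exists t; rewrite // mem_iota /= add0n ltnS (leq_trans ty) // ltnW.
  by rewrite mem_filter th_in andbT.
rewrite /G size_flatten /shape -map_comp sumnE big_map natr_sum.
rewrite -(big_mkord xpredT (realized_cost n)) /index_iota subn0.
apply: ler_sum => t _; rewrite /= size_filter; apply: count_le_sum => th.
exact: threat_cost_ge0.
Qed.

End Realization.

(** * Density *)

(** Natural density zero, expressed in integers only. *)
Definition negligible (P : pred nat) : Prop := forall q, exists X0, forall X,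
  X0 <= X -> q * count P (iota 0 X.+1) <= X.

Lemma negligible_sub (P Q : pred nat) :
  {subset P <= Q} -> negligible Q -> negligible P.
Proof.
move=> PQ h q; have [X0 hX] := h q; exists X0 => X /hX; apply: leq_trans.
by rewrite leq_mul2l sub_count ?orbT.
Qed.

Lemma negligible_or (P Q : pred nat) :
  negligible P -> negligible Q -> negligible (fun n => P n || Q n).
Proof.
move=> hP hQ q; have [X1 h1] := hP (2 * q); have [X2 h2] := hQ (2 * q).
exists (maxn X1 X2) => X; rewrite geq_max => /andP[/h1 {}h1 /h2 {}h2].
have : count (fun n => P n || Q n) (iota 0 X.+1) <=
    count P (iota 0 X.+1) + count Q (iota 0 X.+1).
  by rewrite -count_predUI leq_addr.
by move: h1 h2; clear; nia.
Qed.

Lemma negligible_bounded n0 : negligible (fun n => n < n0).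
Proof.
move=> q; exists (q * n0) => X; apply: leq_trans; rewrite leq_mul2l; apply/orP; right.
rewrite -size_filter -[leqRHS](size_iota 0); apply: uniq_leq_size.
  by rewrite filter_uniq // iota_uniq.
by move=> n; rewrite mem_filter !mem_iota /= add0n => /andP[].
Qed.

(** Tile by windows of length [T = 2 ^ (2 * s)], in which the smoothness bound is at most
    [2 ^ (s + 2)], about [4 * sqrt T]. So the primes up to it are a vanishing proportion of [T]. *)
Lemma negligible_smooth : negligible (fun n => ~~ rough n).
Proof.
move=> q; pose s1 := (32 * q + 8).
pose N0 := 2 ^ (s1 ^ 4).
have tile t : N0 <= t -> [/\ 0 < 2 ^ (2 * scale t), 3 * q * 2 ^ (2 * scale t) <= t &
    3 * q * count (fun n => ~~ rough n) (iota t (2 ^ (2 * scale t))) <= 2 ^ (2 * scale t)].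
  move=> N0t; set s := scale t; set T := 2 ^ (2 * s).
  have ss : s1 <= s by exact: scale_ge.
  have s8 : 8 <= s by move: ss; rewrite /s1; clear; lia.
  have st : 2 ^ (s ^ 4) <= t by apply: scale_leq_exp; apply: leq_trans s8.
  have s64 : 64 * s <= s ^ 4 by apply: exp4_ge; apply: leq_trans s8.
  have qs : 32 * q <= 2 ^ s.
    by apply: leq_trans (ltnW (ltn_expl s (ltnSn 1))); move: ss; rewrite /s1; clear; lia.
  have T0 : 0 < T by rewrite expn_gt0.
  have TT : T = 2 ^ s * 2 ^ s by rewrite /T mul2n -addnn expnD.
  have s2 : 2 <= s by apply: leq_trans s8.
  have tT : 4 * T * 2 ^ s <= t.
    apply: leq_trans st; rewrite /T -[4]/(2 ^ 2) -!expnD leq_exp2l //.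
    by move: s64 s8; clear; lia.
  split=> //; first by move: tT qs; clear; nia.
  have t0 : 0 < t by apply: leq_trans st; rewrite expn_gt0.
  have [e le_e fe] := smooth_count t T (2 ^ s.+2) t0.
  have cnt : count (fun n => ~~ rough n) (iota t T) <= count (smooth (2 ^ s.+2)) (iota t T).
    rewrite -!size_filter; apply: uniq_leq_size; first by rewrite filter_uniq // iota_uniq.
    move=> n; rewrite !mem_filter mem_iota negbK => /andP[sm /andP[tn nt]].
    rewrite tn nt !andbT; apply: sub_all sm => p /leq_trans; apply; rewrite leq_exp2l //.
    apply: (@leq_trans (scale (2 * (2 * t)))).
      by apply: scale_mono; move: tT nt; have := expn_gt0 2 s; clear; nia.
    by apply: leq_trans (scale_double _) _; rewrite ltnS scale_double.
  (* From [2 ^ (s ^ 4 * e) <= t ^ e <= T! <= T ^ T = 2 ^ (2 * s * T)]. *)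
  have te : e * s ^ 3 <= 2 * T.
    have : 2 ^ (s ^ 4 * e) <= 2 ^ (2 * s * T).
      rewrite expnM [X in _ <= X]expnM -/T.
      apply: leq_trans (leq_trans fe (fact_le_exp T)).
      by have [->//|e0] := posnP e; rewrite leq_exp2r.
    rewrite leq_exp2l // expnS.
    have : 0 < s by apply: leq_trans s8.
    by clear; nia.
  have s3 : 12 * q <= s ^ 3.
    apply: (@leq_trans (s ^ 1)); first by rewrite expn1; move: ss; rewrite /s1; clear; lia.
    by rewrite leq_pexp2l //; apply: leq_trans s8.
  have primes_le : count prime (iota 0 (2 ^ s.+2).+1) <= (2 ^ s.+2).+1.
    by rewrite -[leqRHS](size_iota 0) count_size.
  move: (leq_trans cnt le_e) primes_le te s3 qs TT.
  have -> : 2 ^ s.+2 = 4 * 2 ^ s by rewrite -(expnD 2 2).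
  set a := count (fun _ => _) _; set b := count _ (iota 0 _).
  move: a b (2 ^ s) (s ^ 3) => a b u v.
  clear; move=> a_le b_le te s3 qs TT.
  have h1 : 12 * q * e <= 2 * T by apply: leq_trans te; rewrite mulnC leq_mul2l s3 orbT.
  have h2 : 32 * q * u <= T by rewrite TT leq_mul2r qs orbT.
  have h3 : 3 * q * a <= 3 * q * (4 * u).+1 + 3 * q * e.
    by rewrite -mulnDr leq_mul2l (leq_trans a_le) ?orbT // leq_add2r.
  have [u0|u0] := posnP u; first by move: h3 h1 TT qs; rewrite u0; clear; nia.
  by move: h1 h2 h3 u0; clear; nia.
have hq := count_tile _ _ _ _ tile.
exists (3 * (q * N0) + N0 + 2) => X XN.
have : count (fun n => ~~ rough n) (iota 0 X.+1) <=
    N0 + count (fun n => ~~ rough n) (iota N0 (X.+1 - N0)).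
  rewrite -{1}(subnKC (_ : N0 <= X.+1)); last by move: XN; clear; lia.
  by rewrite iotaD count_cat leq_add2r (leq_trans (count_size _ _)) // size_iota.
move: (hq (X.+1 - N0)) XN; move: (count _ _) (count _ _) => a b; clear.
by rewrite -mulnA => h XN ab; have := leq_mul (leqnn q) ab; rewrite mulnDr; lia.
Qed.

Lemma coin_rate_sum (Q : nat) : 0 < Q -> exists Y, forall n,
  (\sum_(m < n) coin_rate m <= Y%:R + n%:R / Q%:R)%R.
Proof.
move=> Q0; exists (2 ^ (Q ^ 4)); elim=> [|n IHn].
  by rewrite big_ord0 mul0r addr0 ler0n.
have [le_n|lt_n] := leqP (2 ^ (Q ^ 4)) n.
  rewrite big_ord_recr -[(n.+1%:R)%R]natr1 mulrDl mul1r addrA lerD //.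
  have Qs := scale_ge _ _ le_n.
  by rewrite /coin_rate lef_pV2 ?posrE ?ltr0n ?ler_nat // (leq_trans Q0).
apply: (@le_trans _ _ (\sum_(m < n.+1) 1)%R).
  by apply: ler_sum => m _; have /andP[] := coin_rate01 m.
rewrite sumr_const card_ord; apply: (@le_trans _ _ ((2 ^ (Q ^ 4))%N%:R)%R).
  by rewrite ler_nat.
by rewrite lerDl divr_ge0 ?ler0n.
Qed.

Section Density.

Variables (n0 s0 : nat) (c : nat -> bool).
Hypothesis n0_ge2 : 2 <= n0.
Hypothesis s0_ge : 96 <= s0.
Hypothesis n0_ge : 2 ^ (s0 ^ 4) <= n0.
Hypothesis s0_count : forall s, s0 <= s ->
  48 * (long_min s + long_min s * (first_bound s * (first_bound s *
    (8 * (long_min s))))) + 208 <= 2 ^ s.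
Hypothesis c_cost : forall n,
  (\sum_(m < n) (~~ c m)%:R + \sum_(t < n.+1) realized_cost n0 c n t <=
   \sum_(m < n) coin_rate m + \sum_(t < n.+1) coin_rate t)%R.

Local Notation B := (elts n0 c).

Lemma negligible_zeros_medium :
  negligible (fun n => ~~ c n || ((n0 <= n) && medium n0 c n)).
Proof using All.
move=> q; have [Y hY] := coin_rate_sum (4 * q + 4) ltac:(lia).
exists (2 * Y * (2 * q + 2) + 4) => X XY.
have h := zeros_medium_count n0 s0 c n0_ge2 s0_ge n0_ge s0_count c_cost X.+1.
have {}h := le_trans h (lerD (hY X.+1) (hY X.+2)).
set N := (count _ _ + _)%N in h.
have cN : count (fun n => ~~ c n || (n0 <= n) && medium n0 c n) (iota 0 X.+1) <= N.
  by rewrite /N -count_predUI leq_addr.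
apply: (@leq_trans (q * N)); first by rewrite leq_mul2l cN orbT.
have : (N * (4 * q + 4) <= 2 * Y * (4 * q + 4) + X.+1 + X.+2)%N.
  have Q0 : (0 < (4 * q + 4)%:R :> rat)%R by rewrite ltr0n addn4.
  rewrite -(ler_nat rat) natrD natrD natrM [(2 * Y * _)%:R%R]natrM natrM.
  move: ((4 * q + 4)%:R)%R Q0 h => D Q0; rewrite -(ler_pM2r Q0) !mulrDl !divfK ?gt_eqF //.
  by rewrite [(X.+2%:R)%R](natrD _ 1 X.+1); lra.
by move: XY; clear; nia.
Qed.

Definition short y := forced (B y) y && ((witness (B y) y).2 < short_max (scale y)).

(** Let [d] be the first element of I; then [i <= d] and [d ^ (r + 2) <= X ^ (r + 1)]. If
    [d * 2 ^ s > X], then [X < 2 ^ (s * (r + 2))], against [r + 2 <= s ^ 3] and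
    [2 ^ (s ^ 4) <= X]. *)
Lemma short_first_bound y i k r X : y <= X -> 8 <= scale X -> r < short_max (scale y) ->
  clash (B y) y i k r -> [/\ i <= X %/ 2 ^ scale X,
    k < len_bound (scale X) * (scale X) ^ 3 & r < scale X ^ 3].
Proof using n0_ge2.
move=> yX s8 r_short cl; set s := scale X.
have sy : scale y <= s by exact: scale_mono.
have Bs := elts_sorted n0 c y; have Bb := @elts_bound n0 c n0_ge2 y.
have r2 : r.+2 <= s ^ 3.
  have : scale y ^ 3 <= s ^ 3 by rewrite leq_exp2r.
  have : 2 <= scale y by move: r_short; rewrite /short_max; case: (scale y) => [|[|x]] //; rewrite exp1n.
  by move: r_short; rewrite /short_max; clear; lia.
have k_lt := clash_length _ y Bs Bb _ _ _ _ (scale_lt y) cl.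
have rk := clash_rest_lt _ y Bs Bb _ _ _ cl.
have first_le := clash_first _ y Bs Bb _ _ _ cl.
have iB : i < size (B y) by case/and3P: cl => k0 + _; move: k0; clear; lia.
split.
- set d := nth 0 (B y) i in first_le.
  have d0 : 0 < d by have := nth_bound _ _ Bb i iB; rewrite -/d; clear; lia.
  apply: (@leq_trans d).
    have := @nth_gap _ Bs 0 i; rewrite iB => /(_ isT); rewrite -/d; clear; lia.
  rewrite leq_divRL ?expn_gt0 // leqNgt; apply/negP => big.
  have dX : d ^ r.+2 <= X ^ r.+1.
    apply: (@leq_trans (d ^ k)); first by rewrite leq_pexp2l.
    by apply: leq_trans first_le _; rewrite leq_exp2r.
  have : X ^ r.+2 < (d * 2 ^ s) ^ r.+2 by rewrite ltn_exp2r.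
  rewrite expnMn -expnM expnS => lt1.
  have pX : 2 ^ (s * r.+2) <= X.
    apply: leq_trans (scale_leq_exp X (leq_trans _ s8)) => //; rewrite leq_exp2l // -/s.
    by rewrite [s ^ 4]expnS leq_mul2l r2 orbT.
  have : d ^ r.+2 * 2 ^ (s * r.+2) <= X * X ^ r.+1 by rewrite mulnC leq_mul.
  by rewrite leqNgt lt1.
- apply: leq_trans k_lt _; rewrite leq_mul ?len_bound_mono //.
  by move: r2; clear; lia.
by move: r2; clear; lia.
Qed.

(** The triple [(i, k, r)] determines [y], and up to [X] there are about [X / 2 ^ s] values of [i]
    and polynomially many (in [s]) of [k] and [r]. *)
Lemma negligible_short : negligible short.
Proof using n0_ge2.
move=> q.
pose P s := s ^ 3 * ((len_bound s * s ^ 3)).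
have [s1 hs1] : exists s1, forall s, s1 <= s -> 2 * q * P s <= 2 ^ s.
  apply: (poly_le_exp2_eventually 10 (2 * q)) => s.
  rewrite leq_mul2l; apply/orP; right.
  rewrite /P /len_bound (_ : 10 = 3 + (4 + 3))%N // !expnD.
  by rewrite !leq_mul // leq_exp2r.
exists (2 ^ ((s1 + 8) ^ 4)) => X XN; set s := scale X.
have ss : s1 + 8 <= s by exact: scale_ge.
have s8 : 8 <= s by move: ss; clear; lia.
pose F := seq.filter short (iota 0 X.+1).
pose w n := witness (B n) n.
pose fs : seq ((nat -> nat) * nat) := [:: ((fun n => (w n).2), s ^ 3);
  ((fun n => (w n).1.2), len_bound s * s ^ 3); ((fun n => (w n).1.1), (X %/ 2 ^ s).+1)].
have inF n : n \in F -> [/\ n <= X, clash (B n) n (w n).1.1 (w n).1.2 (w n).2 &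
    (w n).2 < short_max (scale n)].
  rewrite mem_filter mem_iota add0n ltnS => /andP[/andP[/witnessP cl h] nX].
  by [].
have szF : size F <= P s * (X %/ 2 ^ s).+1.
  have <- : \prod_(fb <- fs) fb.2 = P s * (X %/ 2 ^ s).+1.
    by rewrite !big_cons big_nil /= muln1 /P !mulnA.
  apply: size_le_prod; first by rewrite filter_uniq // iota_uniq.
    move=> n /inF[nX cl h]; have [h1 h2 h3] := short_first_bound n _ _ _ X nX s8 h cl.
    by rewrite /= h2 h3 ltnS h1.
  move=> m n /inF[_ clm _] /inF[_ cln _] /=; rewrite andbT => /and3P[/eqP e1 /eqP e2 /eqP e3].
  by apply: (clash_determines n0 c n0_ge2 m n _ _ _ clm); rewrite e1 e2 e3.
rewrite -size_filter -/F.
have X1 : 0 < X %/ 2 ^ s.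
  rewrite divn_gt0 ?expn_gt0 //.
  apply: leq_trans (scale_leq_exp X (leq_trans _ s8)) => //; rewrite leq_exp2l // -/s.
  by rewrite -{1}[s]expn1 leq_pexp2l // (leq_trans _ s8).
have := hs1 s (leq_trans (leq_addr _ _) ss); have := leq_trunc_div X (2 ^ s).
by move: szF X1; move: (P s) (X %/ 2 ^ s) (2 ^ s) => p x e; clear; nia.
Qed.

Lemma negligible_not_admitted : negligible (fun n => ~~ admitted n0 c n).
Proof using All.
have := negligible_or _ _ (negligible_or _ _ (negligible_bounded n0) negligible_smooth)
  (negligible_or _ _ negligible_zeros_medium negligible_short).
apply: negligible_sub => n; rewrite !unfold_in /admitted.
have [//|n0n] := ltnP n n0; case Ec : (c n); rewrite ?orbT //=.
case Er : (rough n) => //=; rewrite negbK => Ef.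
by rewrite /medium /short Er Ef /=; case: leqP.
Qed.

End Density.

(** * Enumeration *)

Lemma long_min_poly s : long_min s <= 8 * s.+1 ^ 5.
Proof. by rewrite /long_min /len_bound [s.+1 ^ 5]expnS mulnA leq_mul // leq_mul. Qed.

Lemma first_bound_poly s : first_bound s <= 9 * s.+1 ^ 9.
Proof.
rewrite /first_bound /len_bound (_ : 9 * s.+1 ^ 9 = s.+1 ^ 4 * (9 * s.+1 ^ 5)).
  rewrite leq_mul2l; apply/orP; right; have := long_min_poly s.
  by have := expn_gt0 s.+1 5; clear; lia.
by rewrite mulnCA -expnD.
Qed.

Lemma parameter_exists : exists s0, [/\ 96 <= s0,
  forall s, s0 <= s -> 48 * (long_min s + long_min s * (first_bound s *
    (first_bound s * (8 * (long_min s))))) + 208 <= 2 ^ s,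
  forall s, s0 <= s -> 3 * s * ((long_min s.+1).+1 *
    (first_bound s.+1 * (2 ^ s.+1).+1)) <= 2 ^ (s ^ 2 - 1) &
  forall s, s0 <= s -> 6 + s + len_bound s <= 2 ^ (s - 4)].
Proof.
have [s1 h1] : exists s1, forall s, s1 <= s -> 48 * (long_min s + long_min s *
    (first_bound s * (first_bound s * (8 * (long_min s))))) + 208 <= 2 ^ s.
  (* The degree is [5 + 9 + 9 + 5], from [long_min_poly] and [first_bound_poly]. *)
  apply: (poly_le_exp2_eventually 28 (48 * (8 + 8 * (9 * (9 * (8 * 8)))) + 208)) => s.
  have l := long_min_poly s; have f := first_bound_poly s.
  have x1 k : 0 < s.+1 ^ k by rewrite expn_gt0.
  have l28 : long_min s <= 8 * s.+1 ^ 28.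
    by apply: leq_trans l _; rewrite leq_mul2l leq_pexp2l.
  have := leq_mul l (leq_mul f (leq_mul f (leq_mul (leqnn 8) l))).
  have -> : 8 * s.+1 ^ 5 * (9 * s.+1 ^ 9 * (9 * s.+1 ^ 9 * (8 * (8 * s.+1 ^ 5)))) =
      8 * (9 * (9 * (8 * 8))) * s.+1 ^ 28.
    rewrite (_ : 28 = 5 + (9 + (9 + 5))) // !expnD.
    by move: (s.+1 ^ 5) (s.+1 ^ 9) => a b; ring.
  move: (long_min s * _) => Y; have := x1 28; move: (s.+1 ^ 28) l28 => x.
  move: (long_min s) (8 * (9 * (9 * (8 * 8)))) => L K; clear; nia.
have [s2 h2] : exists s2, forall s, s2 <= s ->
    3 * s * ((long_min s).+1 * first_bound s) <= 2 ^ s.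
  apply: (poly_le_exp2_eventually 15 (3 * (9 * 9))) => s.
  have l : (long_min s).+1 <= 9 * s.+1 ^ 5.
    have := long_min_poly s; have := expn_gt0 s.+1 5; clear; lia.
  have := leq_mul (leqnn 3) (leq_mul (leqnSn s) (leq_mul l (first_bound_poly s))).
  rewrite mulnA => /leq_trans; apply.
  rewrite (_ : s.+1 ^ 15 = s.+1 * (s.+1 ^ 5 * s.+1 ^ 9)); last first.
    by rewrite -expnD -expnS.
  by move: (s.+1 ^ 5) (s.+1 ^ 9) => a b; rewrite leq_eqVlt; apply/orP; left; apply/eqP; ring.
have [s3 h3] : exists s3, forall s, s3 <= s -> 16 * (6 + s + len_bound s) <= 2 ^ s.
  apply: (poly_le_exp2_eventually 4 (16 * 7)) => s.
  have : s.+1 <= s.+1 ^ 4 by rewrite -{1}[s.+1]expn1 leq_pexp2l.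
  by rewrite /len_bound; move: (s.+1 ^ 4); clear; lia.
exists (96 + s1 + s2 + s3); split=> [|s hs|s hs|s hs].
- by rewrite -!addnA leq_addr.
- by apply: h1; move: hs; clear; lia.
- have s5 : 5 <= s by move: hs; clear; lia.
  have /h2 h : s2 <= s.+1 by move: hs; clear; lia.
  apply: (@leq_trans (2 ^ s.+1 * 2 ^ s.+2)).
    apply: leq_trans (leq_trans _ (leq_mul h (leqnn (2 ^ s.+1).+1))) _.
      move: (long_min _).+1 (first_bound _) (2 ^ s.+1).+1 => a f p.
      rewrite (_ : 3 * s * (a * (f * p)) = s * (3 * (a * f) * p)); last by ring.
      rewrite (_ : 3 * s.+1 * (a * f) * p = s.+1 * (3 * (a * f) * p)); last by ring.
      by rewrite leq_mul2r leqnSn orbT.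
    rewrite leq_mul2l; apply/orP; right.
    by rewrite [2 ^ s.+2]expnS; have := expn_gt0 2 s.+1; move: (2 ^ s.+1); clear; lia.
  rewrite -expnD leq_exp2l //; move: s5; rewrite expnS expn1; clear; nia.
have s4 : 4 <= s by move: hs; clear; lia.
have /h3 : s3 <= s by move: hs; clear; lia.
by rewrite -{3}(subnK s4) expnD mulnC leq_mul2r.
Qed.

Lemma sequence_exists : exists n0 c, 2 <= n0 /\
  negligible (fun n => ~~ admitted n0 c n).
Proof.
have [s0 [s96 h1 h2 h3]] := parameter_exists.
pose n0 := 2 ^ (s0 ^ 4).
have n02 : 2 <= n0.
  by rewrite -[2]/(2 ^ 1) leq_exp2l // expn_gt0 (leq_trans _ s96).
have mean h := threats_mean n0 s0 h n02 s96 (leqnn _) h2 h3.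
have [c hc] := derandomization coin_rate coin_rate01 (threats n0) coin_rate
  (threats_ok n0) mean.
exists n0, c; split=> //.
exact: (negligible_not_admitted n0 s0 c n02 s96 (leqnn _) h1 hc).
Qed.

(** * From disjoint blocks to arbitrary blocks *)

Section Injectivity.

Variable d : nat -> nat.
Hypothesis d_ge2 : forall i, 0 < i -> 2 <= d i.
Hypothesis d_disjoint : forall u v u' v', 0 < u <= v -> v < u' <= v' ->
  \prod_(u <= i < v.+1) d i <> \prod_(u' <= i < v'.+1) d i.

Lemma prod_gt0 a b : 0 < a -> 0 < \prod_(a <= i < b) d i.
Proof using d_ge2.
move=> a0; rewrite big_seq_cond prodn_cond_gt0 // => i.
by rewrite mem_index_iota andbT => /andP[ai _]; rewrite ltnW // d_ge2 // (leq_trans a0).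
Qed.

Lemma prod_gt1 a b : 0 < a < b -> 1 < \prod_(a <= i < b) d i.
Proof using d_ge2.
case/andP=> a0 ab; rewrite big_ltn //.
by have := d_ge2 a a0; have := prod_gt0 a.+1 b isT; clear; nia.
Qed.

Lemma block_products_injective u v u' v' : 0 < u <= v -> 0 < u' <= v' ->
  \prod_(u <= i < v.+1) d i = \prod_(u' <= i < v'.+1) d i -> (u, v) = (u', v').
Proof using All.
wlog vv' : u v u' v' / v <= v' => [hw|].
  case: (leqP v v') => [|/ltnW] h uv uv' E; first exact: hw.
  by apply/esym; exact: hw.
move=> /andP[u0 uv] /andP[u'0 uv'] E.
have split a b e : a <= b -> b <= e ->
  \prod_(a <= i < e) d i = (\prod_(a <= i < b) d i) * \prod_(b <= i < e) d i.
  by move=> ab be; rewrite (big_cat_nat ab be).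
have cancel X Y Z : 0 < X -> X = Y * (X * Z) -> Y = 1 /\ Z = 1.
  move=> X0 XE; have : Y * Z == 1 by rewrite -(eqn_pmul2l X0) muln1 mulnCA -XE.
  by rewrite muln_eq1 => /andP[/eqP -> /eqP ->].
(* Nested blocks: the surplus on either side has product 1, hence is empty as all factors are at
   least 2. *)
have [u'u|uu'] := leqP u' u.
  have e1 := split u' u v'.+1 u'u ltac:(move: uv vv'; clear; lia).
  have e2 := split u v.+1 v'.+1 ltac:(move: uv; clear; lia) vv'.
  have p1 := prod_gt0 u' u u'0; have p2 := prod_gt0 u v.+1 u0.
  have p3 := prod_gt0 v.+1 v'.+1 isT.
  have [Y1 Z1] : \prod_(u' <= i < u) d i = 1 /\ \prod_(v.+1 <= i < v'.+1) d i = 1.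
    by apply: (cancel (\prod_(u <= i < v.+1) d i)) => //; rewrite {1}E e1 e2.
  have u'E : u' = u.
    apply/eqP; rewrite eqn_leq u'u leqNgt; apply/negP => lt_u.
    by have := prod_gt1 u' u; rewrite u'0 lt_u Y1 => /(_ isT).
  have v'E : v = v'.
    apply/eqP; rewrite eqn_leq vv' leqNgt; apply/negP => lt_v.
    by have := prod_gt1 v.+1 v'.+1; rewrite !ltnS lt_v leq0n Z1 => /(_ isT).
  by rewrite u'E v'E.
have [vu'|u'v] := ltnP v u'.
  by case: (d_disjoint u v u' v') => //; rewrite ?u0 ?vu'.
have e1 := split u u' v.+1 (ltnW uu') (leqW u'v).
have e2 := split u' v.+1 v'.+1 (leqW u'v) vv'.
have p2 := prod_gt0 u' v.+1 u'0.
(* Overlapping blocks: cancelling the overlap leaves two disjoint ones, the second possibly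
   empty. *)
have E' : \prod_(u <= i < u') d i = \prod_(v.+1 <= i < v'.+1) d i.
  by apply/eqP; rewrite -(eqn_pmul2r p2) -e1 E e2 mulnC.
have [lt_v|ge_v] := ltnP v v'; last first.
  have := prod_gt1 u u'; rewrite u0 uu' => /(_ isT).
  by rewrite E' big_geq.
case: (d_disjoint u u'.-1 v.+1 v').
- by rewrite u0 -ltnS prednK.
- by rewrite lt_v andbT prednK ?leqW.
by rewrite prednK.
Qed.

End Injectivity.

Section Enumeration.

Variables (n0 : nat) (c : nat -> bool).
Hypothesis n0_ge2 : 2 <= n0.
Hypothesis infinite : forall i, exists n, i <= size (elts n0 c n).

Local Notation B := (elts n0 c).

(** The enumeration counts from 1 and lists from 0, whence the predecessor. *)
Definition enum_elt i := nth 0 (B (ex_minn (infinite i))) i.-1.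

Lemma enum_eltE n i : 0 < i <= size (B n) -> enum_elt i = nth 0 (B n) i.-1.
Proof using Type.
move=> /andP[i0 i_n]; rewrite /enum_elt; case: ex_minnP => m i_m _.
have [mn|/ltnW nm] := leqP m n.
  by rewrite (nth_elts n0 c m n) // prednK.
by rewrite [RHS](esym (nth_elts n0 c n m _ nm _)) // prednK.
Qed.

Lemma enum_elt_admitted i : 0 < i -> admitted n0 c (enum_elt i) /\
  size (B (enum_elt i)) = i.-1.
Proof using n0_ge2.
move=> i0; have [n i_n] := infinite i.
have lt_i : i.-1 < size (B n) by rewrite prednK.
rewrite (enum_eltE n) ?i0 //; split.
  by have := mem_nth 0 lt_i; rewrite elts_memE => /andP[].
have := nth_elts_start n0 c n0_ge2 n i.-1 lt_i; by case.
Qed.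

Lemma enum_elt_ltn i j : 0 < i -> i < j -> enum_elt i < enum_elt j.
Proof using Type.
move=> i0 ij; have [n j_n] := infinite j; have j0 : 0 < j by exact: leq_trans ij.
rewrite !(enum_eltE n) ?i0 ?j0 //; last by rewrite (leq_trans (ltnW ij)).
have := @nth_gap _ (elts_sorted n0 c n) i.-1 j.-1; move: i0 ij j_n j0; clear; lia.
Qed.

Lemma enum_elt_surj m : admitted n0 c m -> exists2 i, 0 < i & enum_elt i = m.
Proof using Type.
move=> am; exists (size (B m)).+1 => //.
have BE : B m.+1 = rcons (B m) m by rewrite /= ifT.
rewrite (enum_eltE m.+1) BE ?size_rcons ?leqnn //=.
by rewrite nth_rcons ltnn eqxx.
Qed.

Lemma block_enum n i k : 0 < i -> i.-1 + k <= size (B n) ->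
  block (B n) i.-1 k = \prod_(i <= a < i + k) enum_elt a.
Proof using Type.
move=> i0 h; have -> : \prod_(i <= a < i + k) enum_elt a = \prod_(0 <= a < k) enum_elt (a + i).
  by rewrite -{1}[i]add0n [i + k]addnC big_addn addnK.
rewrite big_mkord.
apply: eq_bigr => a _; have ak := ltn_ord a.
rewrite (enum_eltE n) ?addn_gt0 ?i0 ?orbT //=; last by move: i0 h ak; clear; lia.
by congr nth; move: i0; clear; lia.
Qed.

Lemma enum_elt_disjoint u v u' v' : 0 < u <= v -> v < u' <= v' ->
  \prod_(u <= i < v.+1) enum_elt i <> \prod_(u' <= i < v'.+1) enum_elt i.
Proof using n0_ge2.
move=> /andP[u0 uv] /andP[vu' uv'] E.
have v'0 : 0 < v' by move: vu' uv'; clear; lia.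
have u'0 : 0 < u' by move: vu'; clear; lia.
have [ay sz] := enum_elt_admitted v' v'0; set y := enum_elt v' in ay sz.
case/and4P: ay => _ _ _ /negP; apply; apply/forcedP.
exists u.-1, (v.+1 - u), (v' - u'); apply/and3P; split.
- by move: uv; clear; lia.
- by rewrite sz; move: u0 uv vu' uv'; clear; lia.
rewrite (_ : size (B y) - (v' - u') = u'.-1); last first.
  by rewrite sz; move: uv' u'0; clear; lia.
rewrite !block_enum ?sz //; try by move: u0 u'0 uv vu' uv'; clear; lia.
rewrite !subnKC // ?leqW // E big_nat_recr //=.
Qed.

End Enumeration.

Lemma infinite_of_negligible n0 c : negligible (fun n => ~~ admitted n0 c n) ->
  forall i, exists n, (i <= size (elts n0 c n))%N.
Proof.
move=> h i; have [X0 hX] := h 2; exists (X0 + 2 * i).+1.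
have := hX (X0 + 2 * i) (leq_addr _ _).
rewrite elts_filter size_filter.
have := count_predC (admitted n0 c) (iota 0 (X0 + 2 * i).+1).
rewrite size_iota; have -> : count (predC (admitted n0 c)) (iota 0 (X0 + 2 * i).+1) =
  count (fun n => ~~ admitted n0 c n) (iota 0 (X0 + 2 * i).+1) by [].
move: (count _ _) (count _ _) => a b; clear; lia.
Qed.

Local Open Scope classical_set_scope.
Local Open Scope ring_scope.

Lemma density_one_of_negligible (R : realType) (P : pred nat) :
  negligible (fun n => ~~ P n) -> natural_density_one R [set n | P n].
Proof.
move=> h; apply/cvgrPdist_le => e e0.
(* Exceptions of proportion at most [1 / q] are then within [e]. *)
have [q hq] : exists q : nat, e^-1 <= q%:R.
  by exists (Num.trunc e^-1).+1; rewrite ltW // truncnS_gt.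
have [X0 hX] := h q; exists X0.+1 => //= X /= XX.
have X_gt0 : (0 < X%:R :> R) by rewrite ltr0n (leq_trans _ XX).
set k := counting_function _ X.
have kE : (k + count (fun n => ~~ P n) (iota 1 X) = X)%N.
  rewrite -[RHS](size_iota 1 X) -(count_predC P); congr addn.
  by apply: eq_count => n; rewrite /= mem_setE.
have small : (q * count (fun n => ~~ P n) (iota 1 X) <= X)%N.
  apply: leq_trans (hX X (ltnW XX)); rewrite leq_mul2l; apply/orP; right.
  by rewrite /= leq_addl.
have -> : 1 - k%:R / X%:R = (count (fun n => ~~ P n) (iota 1 X))%:R / X%:R :> R.
  have -> : X%:R = k%:R + (count (fun n => ~~ P n) (iota 1 X))%:R :> R by rewrite -natrD kE.
  by field; rewrite -natrD kE lt0r_neq0.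
rewrite ger0_norm ?divr_ge0 ?ler0n // ler_pdivrMr //.
move: small; rewrite -(ler_nat R) natrM => small.
rewrite -ler_pdivrMl //; apply: le_trans small.
by rewrite ler_wpM2r ?ler0n.
Qed.

Theorem theorem1p1 (R : realType) :
  exists A : set nat,
    [/\ A `<=` [set n : nat | (1 <= n)%N],
        natural_density_one R A &
        exists2 d : nat -> nat, increasing_enumeration A d &
          forall u v u' v' : nat,
            (1 <= u <= v)%N -> (1 <= u' <= v')%N ->
            block_product d u v = block_product d u' v' ->
            (u, v) = (u', v')].
Proof.
have [n0 [c [n0_ge2 negl]]] := sequence_exists.
have inf := infinite_of_negligible n0 c negl.
have adm_ge2 n : admitted n0 c n -> (2 <= n)%N.
  by case/and4P=> n0n _ _ _; exact: leq_trans n0n.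
exists [set n | admitted n0 c n]; split.
- by move=> n /= /adm_ge2 /ltnW.
- exact: density_one_of_negligible.
exists (enum_elt n0 c inf).
  split; first by move=> i j; exact: enum_elt_ltn.
  apply/seteqP; split=> [m /= [i i0 <-]|m /= /(enum_elt_surj n0 c inf)[i i0 <-]].
    by have [] := enum_elt_admitted n0 c n0_ge2 inf i i0.
  by exists i.
move=> u v u' v'; apply: block_products_injective.
  by move=> i i0; apply: adm_ge2; have [] := enum_elt_admitted n0 c n0_ge2 inf i i0.
exact: enum_elt_disjoint.
Qed.
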